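(* \textsc{Hedge Cluster Deletion} is polynomial-time solvable on hedge graphs for which $\delta_{\max}=O(1)$, i.e., for every fixed constant $c$, it can be solved in polynomial time on hedge graphs whose underlying graph satisfies $\delta_{\max}\le c$.
   Context: A hedge graph $H$ is a simple graph (its underlying graph) whose edge set is partitioned into classes called hedges. For a set $U$ of hedges, $H\setminus U$ is obtained by deleting all edges of the hedges in $U$. \textsc{Hedge Cluster Deletion}: given a hedge graph $H$ and an integer $k\ge 0$, decide whether there is a set $U$ of at most $k$ hedges such that the underlying graph of $H\setminus U$ is a disjoint union of cliques. An $F_3$-packing of a graph is a collection of pairwise vertex-disjoint subgraphs each isomorphic to $P_3$ (path on three vertices) or $K_3$; its size is the number of subgraphs in it. $\delta_{\max}$ denotes the size of a largest $F_3$-packing of the underlying graph. *)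

(* Defs.v *)
From mathcomp Require Import all_boot all_algebra.
Set Implicit Arguments.
Unset Strict Implicit.
Unset Printing Implicit Defensive.

(* A simple graph on [V] is given by its set of edges, which are 2-subsets of
   [V]. *)

Record hedge_graph (V : finType) := HedgeGraph {
  edges : {set {set V}};
  hedges : {set {set {set V}}};
  edges_simple : [forall e in edges, #|e| == 2];
  hedges_partition : partition hedges edges
}.

Definition disjoint_union_of_cliques (V : finType) (E : {set {set V}}) : Prop :=
  exists P : {set {set V}}, partition P [set: V] /\
    forall u v : V, u != v ->
      ([set u; v] \in E <-> exists B, [/\ B \in P, u \in B & v \in B]).

Definition delete_hedges (V : finType) (H : hedge_graph V)
  (U : {set {set {set V}}}) : {set {set V}} := edges H :\: cover U.

Definition hedge_cluster_deletion (V : finType) (H : hedge_graph V) (k : nat) :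
    Prop :=
  exists U : {set {set {set V}}},
    [/\ U \subset hedges H, #|U| <= k
      & disjoint_union_of_cliques (delete_hedges H U)].

Definition P3 : {set {set 'I_3}} :=
  [set [set inord 0; inord 1]; [set inord 1; inord 2]].
Definition K3 : {set {set 'I_3}} := [set e : {set 'I_3} | #|e| == 2].

(* A subgraph is a pair (vertex set, edge set); it need not be induced. *)
Definition subgraph_of (V : finType) (E : {set {set V}})
    (S : {set V} * {set {set V}}) : bool :=
  (S.2 \subset E) && [forall e in S.2, e \subset S.1].

(* [S] is isomorphic to the graph on ['I_3] with edge set [F]. *)
Definition isomorphic_to (V : finType) (F : {set {set 'I_3}})
    (S : {set V} * {set {set V}}) : bool :=
  [exists f : {ffun 'I_3 -> V},
    [&& injectiveb f, S.1 == [set f i | i : 'I_3]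
      & S.2 == [set [set f i | i in e] | e : {set 'I_3} in F]]].

Definition F3_packing (V : finType) (E : {set {set V}})
    (P : {set {set V} * {set {set V}}}) : bool :=
  [forall S in P,
    subgraph_of E S && (isomorphic_to P3 S || isomorphic_to K3 S)] &&
  [forall S in P, forall T in P, (S != T) ==> [disjoint S.1 & T.1]].

Definition delta_max (V : finType) (E : {set {set V}}) : nat :=
  \max_(P : {set {set V} * {set {set V}}} | F3_packing E P) #|P|.

(* A two-way infinite tape: the cells to the left of the head (nearest first),
   the scanned cell, and the cells to its right; [None] is the blank symbol,
   and all cells beyond the two lists are blank. *)
Record tape (G : Type) := Tape {
  tleft : seq (option G);
  thead : option G;
  tright : seq (option G)
}.

Inductive direction := MoveLeft | Stay | MoveRight.

Definition move_tape (G : Type) (m : direction) (t : tape G) : tape G :=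
  let: Tape l x r := t in
  match m with
  | MoveLeft => Tape (behead l) (head None l) (x :: r)
  | Stay => t
  | MoveRight => Tape (x :: l) (head None r) (behead r)
  end.

Definition write_tape (G : Type) (a : option G) (t : tape G) : tape G :=
  Tape (tleft t) a (tright t).

Definition blank_tape (G : Type) : tape G := Tape [::] None [::].

(* The head scans the first symbol of [w]. *)
Definition input_tape (G : Type) (w : seq G) : tape G :=
  let s := map some w in Tape [::] (head None s) (behead s).

(* [A] is the input alphabet; the non-blank tape symbols are those of [A] and
   those of the auxiliary alphabet [aux]. There are [extra.+1] tapes, and the
   input is on tape [ord0]. *)
Record turing_machine (A : finType) := TuringMachine {
  aux : finType;
  extra : nat;
  state : finType;
  start : state;
  accept : state;
  reject : state;
  accept_neq_reject : accept != reject;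
  delta : state -> {ffun 'I_extra.+1 -> option (A + aux)} ->
          state * ('I_extra.+1 -> option (A + aux) * direction)
}.

Definition config (A : finType) (M : turing_machine A) : Type :=
  state M * ('I_(extra M).+1 -> tape (A + aux M)%type).

Definition init_config (A : finType) (M : turing_machine A) (w : seq A) :
    config M :=
  (start M, fun i => if i == ord0 then input_tape (map inl w)
                     else blank_tape (A + aux M)%type).

Definition halted (A : finType) (M : turing_machine A) (q : state M) : bool :=
  (q == accept M) || (q == reject M).

Definition step (A : finType) (M : turing_machine A) (c : config M) : config M :=
  let: (q, t) := c in
  if halted q then c else
  let: (q', act) := delta q [ffun i => thead (t i)] in
  (q', fun i => move_tape (act i).2 (write_tape (act i).1 (t i))).

Definition run (A : finType) (M : turing_machine A) (w : seq A) (t : nat) :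
    config M := iter t (@step A M) (init_config M w).

Definition accepts_within (A : finType) (M : turing_machine A) (w : seq A)
    (t : nat) : Prop := (run M w t).1 = accept M.

Definition rejects_within (A : finType) (M : turing_machine A) (w : seq A)
    (t : nat) : Prop := (run M w t).1 = reject M.

(* The decision problem with instances [x : I], encoded as words by [encodes]
   and with yes-instances [yes], is solvable in polynomial time on the
   instances in [domain]; nothing is required on other inputs. *)
Definition polytime_solvable_on (A : finType) (I : Type)
    (encodes : seq A -> I -> Prop) (yes domain : I -> Prop) : Prop :=
  exists (M : turing_machine A) (p : {poly nat}),
    forall (w : seq A) (x : I), encodes w x -> domain x ->
      (yes x -> accepts_within M w p.[size w]%R) /\
      (~ yes x -> rejects_within M w p.[size w]%R).

Record hcd_instance := HcdInstance {
  num_vertices : nat;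
  graph : hedge_graph 'I_num_vertices;
  budget : nat
}.

(* The input alphabet consists of two binary digits and a separator. *)
Definition letter : finType := option bool.
Definition sep : letter := None.

(* Binary expansion, least significant digit first; [0] is written with one
   digit. *)
Definition binary (m : nat) : seq letter :=
  [seq Some (odd (m %/ 2 ^ i)) | i <- iota 0 (trunc_log 2 m).+1].

Definition edge_of (n : nat) (e : 'I_n * 'I_n) : {set 'I_n} := [set e.1; e.2].

(* [hs] lists every hedge exactly once, each as a list of its edges without
   repetition; the orders and the orientations of the edges are arbitrary. *)
Definition lists_hedges (n : nat) (H : hedge_graph 'I_n)
    (hs : seq (seq ('I_n * 'I_n))) : Prop :=
  perm_eq [seq [set e in map (@edge_of n) h] | h <- hs] (enum (hedges H)) /\
  all (fun h => uniq (map (@edge_of n) h)) hs.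

Definition edge_code (n : nat) (e : 'I_n * 'I_n) : seq letter :=
  binary e.1 ++ sep :: rcons (binary e.2) sep.

Definition hedge_code (n : nat) (h : seq ('I_n * 'I_n)) : seq letter :=
  rcons (flatten (map (@edge_code n) h)) sep.

(* The number of vertices is written in unary, so that the length of the input
   is at least the number of vertices; the budget is written in binary. *)
Definition encodes (w : seq letter) (x : hcd_instance) : Prop :=
  exists2 hs, lists_hedges (graph x) hs &
    w = nseq (num_vertices x) (Some true) ++ sep :: binary (budget x) ++
        sep :: flatten (map (@hedge_code (num_vertices x)) hs).

(* Main.v *)
Require Import Defs.
From mathcomp Require Import all_boot all_algebra zify.
Set Implicit Arguments.
Unset Strict Implicit.
Unset Printing Implicit Defensive.

(** The vertex set [X] of a largest packing has at most [3 c] vertices, and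
    there is no path on three vertices outside [X]. In a solution the clusters
    that meet [X] are cliques with at most two vertices outside [X], so the set
    of pairs of vertices lying in a common such cluster has bounded size. These
    pairs determine a solution that is at least as good: delete exactly the
    hedges that contain an edge with an end in one of these clusters, but not
    inside the cluster; the edges that avoid these clusters form a matching and
    do no harm. So it suffices to try all lists of boundedly many pairs.

    This search only uses finitely many numbers bounded by the length of the
    input, stored as the positions of the heads on copies of the input. Such a
    machine has polynomially many configurations, and being deterministic it
    halts within that number of steps if it halts at all; hence no running time
    has to be analysed. *)

(** * Multi-head automata as Turing machines *)

(** A guess is an arbitrary list of pairs, and its consistency is never checked. Whatever it is, the
    hedges that it cuts form a set of hedges, and it is accepted only if this set fits the budget
    and leaves a transitive adjacency; so an absurd guess does no harm. Conversely, an edge that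
    leaves a cluster of a solution must be deleted, so every hedge cut by the right guess already
    belongs to the solution. Deleting only these hedges may bring back edges, but none with an end
    in a cluster that meets [X].

    The constants: at most [3 c] clusters meet [X], and three vertices of one cluster outside [X]
    would form a path there, so each of these clusters has at most [3 c + 2] vertices.

    Storing numbers as head positions has a price: they are truncated at the length of the input
    plus one. Only the budget, written in binary, can exceed this limit, and its truncation is
    harmless because the hedges are no more numerous than the letters of the input. *)

(* [marker] is written on the cell to the left of the input, so that a head can
   recognize position [0]. *)
Definition symbol : eqType := option (letter + unit).
Definition marker : symbol := Some (inr tt).

Definition full (w : seq letter) : seq symbol :=
  marker :: rcons (map (fun a => Some (inl a)) w) None.

Definition cell (w : seq letter) (p : nat) : symbol := nth None (full w) p.

(** The position of the blank after the input: the last one that a head can reach, hence the largest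
    number that a register can hold. *)
Definition lim (w : seq letter) : nat := (size w).+1.

Lemma size_full w : size (full w) = (lim w).+1.
Proof. by rewrite /full /= size_rcons size_map. Qed.


Lemma cell_marker w p : (cell w p == marker) = (p == 0).
Proof.
case: p => [//|p]; rewrite /cell /full /= nth_rcons size_map.
case: ltnP => [ltp|_]; last by case: ifP.
by rewrite (nth_map None).
Qed.

Lemma cell_blank w p : p <= lim w -> (cell w p == None) = (p == lim w).
Proof.
case: p => [//|p]; rewrite /cell /full /= nth_rcons size_map ltnS eqSS => lep.
case: ltnP => [ltp|gep]; first by rewrite (nth_map None) // (ltn_eqF ltp).
by rewrite (@anti_leq p (size w)) ?lep // eqxx.
Qed.

Lemma cell_letter w p a : (cell w p.+1 == Some (inl a)) = (nth None (map some w) p == Some a).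
Proof.
rewrite /cell /full /= nth_rcons size_map; case: ltnP => [ltp|gep].
  by rewrite !(nth_map None).
by rewrite if_same nth_default ?size_map.
Qed.

Opaque full.

(* A register holds the position of a head. [Inc] and [Dec] have no effect at the
   ends of the tape, and [While r x c] repeats [c] until head [r] scans [x]. *)
Inductive cmd :=
| Inc of nat
| Dec of nat
| Seq of cmd & cmd
| If of nat & symbol & cmd & cmd
| While of nat & symbol & cmd.

(** The additional state [None] of [If] and [While] is the one in which the test is made. *)
Fixpoint ctrl (c : cmd) : finType :=
  match c with
  | Inc _ | Dec _ => unit
  | Seq c1 c2 => (ctrl c1 + ctrl c2)%type
  | If _ _ c1 c2 => option (ctrl c1 + ctrl c2)%type
  | While _ _ c1 => option (ctrl c1)
  end.

Fixpoint entry (c : cmd) : ctrl c :=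
  match c return ctrl c with
  | Inc _ | Dec _ => tt
  | Seq c1 c2 => inl (entry c1)
  | If _ _ c1 c2 => None
  | While _ _ c1 => None
  end.

(** As a next state, [None] means that the command is finished. *)
Fixpoint next (c : cmd) : ctrl c -> (nat -> symbol) ->
    option (ctrl c) * (nat * direction) :=
  match c return ctrl c -> (nat -> symbol) ->
    option (ctrl c) * (nat * direction) with
  | Inc r => fun _ obs => (None, (r, if obs r == None then Stay else MoveRight))
  | Dec r => fun _ obs => (None, (r, if obs r == marker then Stay else MoveLeft))
  | Seq c1 c2 => fun q obs =>
      match q with
      | inl q1 => let: (o, a) := next q1 obs in
                  (Some (if o is Some q' then inl q' else inr (entry c2)), a)
      | inr q2 => let: (o, a) := next q2 obs in (omap inr o, a)
      end
  | If r x c1 c2 => fun q obs =>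
      match q with
      | None => (Some (Some (if obs r == x then inl (entry c1)
                             else inr (entry c2))), (r, Stay))
      | Some (inl q1) => let: (o, a) := next q1 obs in
                         (omap (fun q' => Some (inl q')) o, a)
      | Some (inr q2) => let: (o, a) := next q2 obs in
                         (omap (fun q' => Some (inr q')) o, a)
      end
  | While r x c1 => fun q obs =>
      match q with
      | None => if obs r == x then (None, (r, Stay))
                else (Some (Some (entry c1)), (r, Stay))
      | Some q1 => let: (o, a) := next q1 obs in (Some o, a)
      end
  end.

Fixpoint regs (c : cmd) : nat :=
  match c with
  | Inc r | Dec r => r
  | Seq c1 c2 => maxn (regs c1) (regs c2)
  | If r _ c1 c2 => maxn r (maxn (regs c1) (regs c2))
  | While r _ c1 => maxn r (regs c1)
  end.

Definition safe (o : symbol) (d : direction) : bool :=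
  match d with MoveLeft => o != marker | Stay => true | MoveRight => o != None end.

(** [Inc] and [Dec] look for the ends before they move. So no head leaves the positions from 0 to
    [lim w], on which the finiteness of the configuration space rests. *)
Lemma next_safe c (q : ctrl c) obs :
  let: (_, (r, d)) := next q obs in (r <= regs c) && safe (obs r) d.
Proof.
elim: c q => [r|r|c1 IH1 c2 IH2|r x c1 IH1 c2 IH2|r x c1 IH1] /=.
- by move=> _; rewrite leqnn; case: ifP => //= ->.
- by move=> _; rewrite leqnn; case: ifP => //= ->.
- case=> q; [have := IH1 q|have := IH2 q]; case: next => o [r d] /andP[le_r ->];
    by rewrite leq_max le_r ?orbT.
- case=> [[q|q]|]; last by rewrite leq_maxl.
  + have := IH1 q; case: next => o [r' d] /andP[le_r ->].
    by rewrite !leq_max le_r !orbT.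
  + have := IH2 q; case: next => o [r' d] /andP[le_r ->].
    by rewrite !leq_max le_r !orbT.
- case=> [q|]; last by case: ifP; rewrite leq_maxl.
  by have := IH1 q; case: next => o [r' d] /andP[le_r ->]; rewrite leq_max le_r orbT.
Qed.

Definition shift (d : direction) (p : nat) : nat :=
  match d with MoveLeft => p.-1 | Stay => p | MoveRight => p.+1 end.

Lemma shift_le w d p : p <= lim w -> safe (cell w p) d -> shift d p <= lim w.
Proof.
case: d => //= lep; first by move=> _; apply: leq_trans (leq_pred _) lep.
by rewrite cell_blank // ltn_neqAle lep andbT.
Qed.

Definition store := nat -> nat.

Definition act (a : nat * direction) (s : store) : store :=
  fun r => if r == a.1 then shift a.2 (s r) else s r.

Definition bounded (w : seq letter) (s : store) := forall r, s r <= lim w.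

(** Only terminating executions are derivable, so a proof of [exec] carries the termination from
    which the time bound is drawn. Stores are functions and are therefore compared pointwise. *)
Inductive exec (w : seq letter) (c : cmd) : ctrl c -> store -> store -> Prop :=
| ExecExit q s s' a of next q (fun r => cell w (s r)) = (None, a)
    & s' =1 act a s : exec w q s s'
| ExecStep q q' s s1 s' a of next q (fun r => cell w (s r)) = (Some q', a)
    & s1 =1 act a s & exec w q' s1 s' : exec w q s s'.

Definition runs w c s s' := exec w (entry c) s s'.

Lemma act_stay r s : s =1 act (r, Stay) s.
Proof. by move=> r'; rewrite /act /=; case: ifP. Qed.

Lemma runs_inc w r s s' : s r <= lim w ->
  s' r = minn (s r).+1 (lim w) -> (forall r', r' != r -> s' r' = s r') ->
  runs w (Inc r) s s'.
Proof.
move=> ler eqr neqr; apply: ExecExit; first by [].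
move=> r'; rewrite /act /=; case: eqP => [->|/eqP/neqr//].
rewrite eqr cell_blank //; case: eqP => [->|/eqP ne] /=; first exact/minn_idPr.
by apply/minn_idPl; rewrite ltn_neqAle ne.
Qed.

Lemma runs_dec w r s s' :
  s' r = (s r).-1 -> (forall r', r' != r -> s' r' = s r') ->
  runs w (Dec r) s s'.
Proof.
move=> eqr neqr; apply: ExecExit; first by [].
move=> r'; rewrite /act /=; case: eqP => [->|/eqP/neqr//].
by rewrite eqr cell_marker; case: (s r).
Qed.

Lemma runs_seq w c1 c2 s s1 s2 :
  runs w c1 s s1 -> runs w c2 s1 s2 -> runs w (Seq c1 c2) s s2.
Proof.
rewrite /runs /= => ex1 ex2.
have ex2' (q : ctrl c2) s0 s3 : exec w q s0 s3 ->
    exec w (inr q : ctrl (Seq c1 c2)) s0 s3.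
  elim=> {q s0 s3} [q s0 s3 a E eqs|q q' s0 s3 s4 a E eqs _ IH].
    by apply: ExecExit eqs; rewrite /= E.
  by apply: ExecStep eqs IH; rewrite /= E.
elim: ex1 ex2 => {s s1} [q s s1 a E eqs|q q' s s3 s1 a E eqs _ IH] ex2.
  by apply: ExecStep eqs (ex2' _ _ _ ex2); rewrite /= E.
by apply: ExecStep eqs (IH ex2); rewrite /= E.
Qed.

Lemma runs_if w r x c1 c2 s s' :
  runs w (if cell w (s r) == x then c1 else c2) s s' ->
  runs w (If r x c1 c2) s s'.
Proof.
have ex1 (q : ctrl c1) s0 s3 : exec w q s0 s3 ->
    exec w (Some (inl q) : ctrl (If r x c1 c2)) s0 s3.
  elim=> {q s0 s3} [q s0 s3 a E eqs|q q' s0 s3 s4 a E eqs _ IH].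
    by apply: ExecExit eqs; rewrite /= E.
  by apply: ExecStep eqs IH; rewrite /= E.
have ex2 (q : ctrl c2) s0 s3 : exec w q s0 s3 ->
    exec w (Some (inr q) : ctrl (If r x c1 c2)) s0 s3.
  elim=> {q s0 s3} [q s0 s3 a E eqs|q q' s0 s3 s4 a E eqs _ IH].
    by apply: ExecExit eqs; rewrite /= E.
  by apply: ExecStep eqs IH; rewrite /= E.
move=> ex; apply: ExecStep; [by []|exact: act_stay|].
by case: ifP ex => _; [apply: ex1|apply: ex2].
Qed.

Lemma runs_while_stop w r x c s :
  cell w (s r) == x -> runs w (While r x c) s s.
Proof. by move=> E; apply: ExecExit (act_stay r s); rewrite /= E. Qed.

Lemma runs_while_loop w r x c s s1 s2 :
  cell w (s r) != x -> runs w c s s1 -> runs w (While r x c) s1 s2 ->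
  runs w (While r x c) s s2.
Proof.
move=> /negPf E ex1 ex2.
apply: ExecStep (act_stay r s) _; first by rewrite /= E.
elim: ex1 ex2 => {E s s1} [q s s1 a E eqs|q q' s s3 s1 a E eqs _ IH] ex2.
  by apply: ExecStep eqs ex2; rewrite /= E.
by apply: ExecStep eqs (IH ex2); rewrite /= E.
Qed.

(** A store gives a value to every number, whereas the machine has only the heads from 0 to
    [regs c]. *)
Lemma next_ext c (q : ctrl c) obs obs' :
  (forall r, r <= regs c -> obs r = obs' r) -> next q obs = next q obs'.
Proof.
elim: c q => [r|r|c1 IH1 c2 IH2|r x c1 IH1 c2 IH2|r x c1 IH1] /= q eqo.
- by rewrite eqo.
- by rewrite eqo.
- by case: q => q; [rewrite IH1|rewrite IH2] => // r le_r; apply: eqo;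
    rewrite leq_max le_r ?orbT.
- case: q => [[q|q]|]; last by rewrite eqo // leq_maxl.
  + by rewrite IH1 // => r' le_r; apply: eqo; rewrite !leq_max le_r ?orbT.
  + by rewrite IH2 // => r' le_r; apply: eqo; rewrite !leq_max le_r ?orbT.
- case: q => [q|]; last by rewrite eqo // leq_maxl.
  by rewrite IH1 // => r' le_r; apply: eqo; rewrite !leq_max le_r ?orbT.
Qed.

(** * From terminating programs to time-bounded Turing machines *)

Section Machine.
Variable c : cmd.
Let h := regs c.

(* [inl None] is the state in which the program has stopped, with its result in
   register [0]. *)
Definition mstate : finType := (option (ctrl c) + (bool + bool))%type.
Definition mcopy : mstate := inr (inl false).
Definition mrewind : mstate := inr (inl true).
Definition mhalt (b : bool) : mstate := inr (inr b).

(** The heads move right together and copy the input to every tape, return to the blank before it,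
    write [marker] there and start the program. The final answer is whether register 0 is
    nonzero. *)
Definition mdelta (q : mstate) (v : {ffun 'I_h.+1 -> symbol}) :
    mstate * ('I_h.+1 -> symbol * direction) :=
  match q with
  | inl None => (mhalt (v ord0 != marker), fun i => (v i, Stay))
  | inl (Some q1) =>
      let: (o, (r, d)) := next q1 (fun r => v (inord r)) in
      (inl o, fun i => (v i, if nat_of_ord i == r then d else Stay))
  | inr (inl false) =>
      if v ord0 == None then (mrewind, fun _ => (None, MoveLeft))
      else (mcopy, fun _ => (v ord0, MoveRight))
  | inr (inl true) =>
      if v ord0 == None then (inl (Some (entry c)), fun _ => (marker, Stay))
      else (mrewind, fun i => (v i, MoveLeft))
  | inr (inr b) => (mhalt b, fun i => (v i, Stay))
  end.

Lemma mhalt_neq : mhalt true != mhalt false.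
Proof. by []. Qed.

Definition machine : turing_machine letter :=
  @TuringMachine letter unit h mstate mcopy (mhalt true) (mhalt false)
    mhalt_neq mdelta.

Variable w : seq letter.

(** The blank that ends [full w] is the cell at which copying stops. All heads have visited it, so
    it occurs in the lists of every tape, and tapes can be compared literally. *)
Definition tape_at (p : nat) : tape (letter + unit) :=
  Tape (rev (take p (full w))) (cell w p) (drop p.+1 (full w)).

Lemma move_tape_at d p : p <= lim w -> safe (cell w p) d ->
  move_tape d (tape_at p) = tape_at (shift d p).
Proof.
case: d => //= lep sf; last first.
  have ltp : p.+1 < size (full w).
    by rewrite size_full ltnS ltn_neqAle lep andbT -cell_blank.
  rewrite /tape_at (take_nth None (ltnW ltp)) rev_rcons.
  by rewrite (drop_nth None ltp).
case: p lep sf => [//|p] lep _.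
have ltp : p < size (full w) by rewrite size_full leqW.
rewrite /tape_at (take_nth None ltp) rev_rcons /=; congr Tape.
by rewrite -[LHS](drop_nth None) // size_full.
Qed.

Definition Cfg : finType :=
  (option (ctrl c) * {ffun 'I_h.+1 -> 'I_(lim w).+1})%type.

(** A total function that idles once the program has stopped, so that its orbits can be studied with
    [fconnect] and [findex]. *)
Definition cstep (x : Cfg) : Cfg :=
  if x.1 is Some q then
    let: (o, (r, d)) := next q (fun r => cell w (x.2 (inord r))) in
    (o, [ffun i => inord (if nat_of_ord i == r then shift d (x.2 i) else x.2 i)])
  else x.

Definition represents (t : config machine) (x : Cfg) : Prop :=
  t.1 = inl x.1 /\ forall i, t.2 i = tape_at (x.2 i).

Lemma represents_step t x : represents t x -> x.1 != None ->
  represents (step t) (cstep x).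
Proof.
case: t x => [q t] [[q1|//] g] [/= -> Et] _.
set v := [ffun i => Defs.thead (t i)].
have Ev i : v i = cell w (g i) by rewrite ffunE Et.
rewrite /step /= /cstep /= (@next_ext _ q1 _ (fun r => cell w (g (inord r))));
  last by move=> r _; rewrite Ev.
have := next_safe q1 (fun r => cell w (g (inord r))).
case: next => o [r d] /andP[le_r sf]; split=> //= i.
rewrite Ev Et ffunE; have lei : g i <= lim w by rewrite -ltnS.
case: eqP => [eir|_]; last by rewrite inord_val.
have Ei : inord r = i by apply: val_inj; rewrite /= inordK // -eir.
rewrite Ei in sf; rewrite inordK; last by rewrite ltnS shift_le.
by rewrite -move_tape_at.
Qed.

(** Where [cstep] idles, the machine moves on to its answer; so only the [k'] steps up to the stop
    are simulated. *)
Lemma represents_iter k t x : represents t x -> (iter k cstep x).1 = None ->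
  exists2 k', k' <= k & represents (iter k' (@step _ machine) t) (iter k cstep x).
Proof.
elim: k t x => [|k IH] t x tx; first by exists 0.
rewrite iterSr; case: (boolP (x.1 == None)) => [xN E|xS E].
  have cx : cstep x = x by rewrite /cstep (eqP xN).
  rewrite cx in E *.
  have ->: iter k cstep x = x by elim: (k) => //= n ->.
  by exists 0.
have [k' lek R] := IH _ _ (represents_step tx xS) E.
by exists k'.+1; rewrite // iterSr.
Qed.

Definition restrict (s : store) : {ffun 'I_h.+1 -> 'I_(lim w).+1} :=
  [ffun i => inord (s (nat_of_ord i))].

Lemma act_bounded (q : ctrl c) s o a : bounded w s ->
  next q (fun r => cell w (s r)) = (o, a) -> bounded w (act a s).
Proof.
move=> bs E r; have := next_safe q (fun r => cell w (s r)).
rewrite E; case: a {E} => [r' d] /andP[_ sf]; rewrite /act /=.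
by case: eqP => // ->; rewrite shift_le.
Qed.

Lemma cstep_act (q : ctrl c) s s' o a : bounded w s ->
  next q (fun r => cell w (s r)) = (o, a) -> s' =1 act a s ->
  cstep (Some q, restrict s) = (o, restrict s').
Proof.
move=> bs E eqs; rewrite /cstep /=.
rewrite (@next_ext _ q _ (fun r => cell w (s r))); last first.
  by move=> r le_r; rewrite ffunE !inordK // ltnS.
have /= := next_safe q (fun r => cell w (s r)).
rewrite E; case: a E eqs => r d E eqs /andP[le_r sf]; congr pair.
apply/ffunP=> i; rewrite !ffunE eqs /act /=.
by rewrite !inordK // ltnS.
Qed.

Lemma exec_fconnect (q : ctrl c) s s' : bounded w s -> exec w q s s' ->
  fconnect cstep (Some q, restrict s) (None, restrict s').
Proof.
move=> bs ex; elim: ex bs => {q s s'} [q s s' a E eqs|q q' s s1 s' a E eqs _ IH] bs.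
  by rewrite -(cstep_act bs E eqs) fconnect1.
have bs1 : bounded w s1 by move=> r; rewrite eqs; apply: act_bounded E _.
by apply: connect_trans (IH bs1); rewrite -(cstep_act bs E eqs) fconnect1.
Qed.

Definition word : seq symbol := map (fun a => Some (inl a)) w.

Lemma nth_word k : k < size word -> nth None word k != None.
Proof. by rewrite size_map => ltk; rewrite (nth_map None). Qed.

Lemma run_copy k : k <= size w ->
  (run machine w k).1 = mcopy /\ forall i, (run machine w k).2 i =
    if i == ord0 then Tape (rev (take k word)) (nth None word k) (drop k.+1 word)
    else Tape (rev (take k word)) None [::].
Proof.
elim: k => [_|k IH ltk].
  split=> // i; rewrite /run /= /input_tape -map_comp.
  case: ifP => // _; rewrite take0 -/word; case: word => //= a l; by rewrite drop0.
have [E1 E2] := IH (ltnW ltk); rewrite /run iterS -/(run machine w k).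
case: (run machine w k) E1 E2 => q t /= -> E2.
have ltk' : k < size word by rewrite size_map.
rewrite /step /= ffunE E2 eqxx /=.
have Ek : nth None word k != None by exact: nth_word.
rewrite (negPf Ek) /=; split=> // i; rewrite E2.
rewrite (take_nth None) // rev_rcons; case: ifP => //= _.
case: (ltnP k.+1 (size word)) => lt2; first by rewrite (drop_nth None lt2).
by rewrite !drop_oversize // ?[nth None word k.+1]nth_default // leqW.
Qed.

Lemma run_rewind k : k < size w ->
  (run machine w ((size w).+1 + k)).1 = mrewind /\
  forall i, (run machine w ((size w).+1 + k)).2 i =
    Tape (rev (take (size w - k.+1) word)) (nth None word (size w - k.+1))
         (rcons (drop (size w - k) word) None).
Proof.
have sw : size word = size w by rewrite size_map.
elim: k => [|k IH] ltk; last first.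
  have [E1 E2] := IH (ltnW ltk); rewrite addnS /run iterS -/(run machine w _).
  case: (run machine w _) E1 E2 => q t /= -> E2.
  have lt1 : size w - k.+1 < size word by rewrite sw; lia.
  rewrite /step /= ffunE E2 /=.
  have Ek : nth None word (size w - k.+1) != None by exact: nth_word.
  rewrite (negPf Ek) /=; split=> // i; rewrite ffunE E2.
  have Es : size w - k.+1 = (size w - k.+2).+1 by lia.
  have -> : take (size w - k.+1) word =
      rcons (take (size w - k.+2) word) (nth None word (size w - k.+2)).
    by rewrite Es -take_nth // sw; lia.
  rewrite rev_rcons /=; congr Tape; rewrite [in RHS](drop_nth None lt1) /=.
  by have -> : (size w - k.+1).+1 = size w - k by lia.
rewrite addn0 /run iterS -/(run machine w _).
have [E1 E2] := run_copy (leqnn (size w)).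
case: (run machine w _) E1 E2 => q t /= -> E2.
rewrite /step /= ffunE E2 eqxx /= nth_default ?sw //=.
split=> // i; rewrite E2 subn0 !drop_oversize ?sw //.
have -> : take (size w) word = rcons (take (size w - 1) word) (nth None word (size w - 1)).
  by rewrite -take_nth ?sw; [congr take; lia|lia].
by rewrite rev_rcons /=; case: ifP.
Qed.

(** Copying takes [size w] steps, turning round one, going back [size w], and writing [marker]
    one. *)
Lemma run_start :
  represents (run machine w ((size w).*2.+2)) (Some (entry c), restrict (fun=> 0)).
Proof.
have sw : size word = size w by rewrite size_map.
have Ew : full w = marker :: rcons word None by [].
have [E1 E2] : (run machine w (size w).*2.+1).1 = mrewind /\
   forall i, (run machine w (size w).*2.+1).2 i = Tape [::] None (rcons word None).
  have [w0|w0] := posnP (size w).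
    have Ew0 : word = [::] by apply/eqP; rewrite -size_eq0 sw w0.
    have [E1 E2] := run_copy (leqnn (size w)).
    have -> : (size w).*2.+1 = (size w).+1 by rewrite w0.
    rewrite /run iterS -/(run machine w _); case: (run machine w _) E1 E2 => q t /= -> E2.
    rewrite /step /= ffunE E2 eqxx Ew0 /=; rewrite nth_nil /=.
    by split=> // i; rewrite E2 Ew0; case: ifP.
  have [|E1 E2] := @run_rewind (size w).-1; first by rewrite prednK.
  rewrite -addnn.
  have -> : (size w + size w).+1 = ((size w).+1 + (size w).-1).+1 by lia.
  rewrite /run iterS -/(run machine w _).
  case: (run machine w _) E1 E2 => q t /= -> E2.
  rewrite /step /= ffunE E2 prednK // subnn /=.
  have Ek : nth None word 0 != None by rewrite nth_word ?sw.
  rewrite (negPf Ek) /=; split=> // i; rewrite ffunE E2 prednK // subnn take0 /=.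
  have -> : size w - (size w).-1 = 1 by lia.
  by case: (word) sw w0 => [|a l] /= <- //; rewrite drop0.
rewrite /run iterS -/(run machine w _).
case: (run machine w _) E1 E2 => q t /= -> E2.
rewrite /step /= ffunE E2 /=; split=> //= i.
by rewrite E2 ffunE inordK // /tape_at take0 Ew /= drop0.
Qed.

(** The start-up, one step for the answer, and at most one step for each configuration in [Cfg]. *)
Definition mtime : nat :=
  (size w).*2.+3 + #|ctrl c|.+1 * (size w).+2 ^ h.+1.

Lemma card_Cfg : #|Cfg| = #|ctrl c|.+1 * (size w).+2 ^ h.+1.
Proof. by rewrite card_prod card_option card_ffun !card_ord. Qed.

Lemma run_machine s' : runs w c (fun=> 0) s' -> bounded w s' ->
  (run machine w mtime).1 = mhalt (s' 0 != 0).
Proof.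
move=> /(@exec_fconnect _ _ _ (fun=> leq0n _)) conn bs'.
(* A deterministic run that reaches its end repeats no configuration: [findex] is smaller than the
   size of the orbit, hence than that of [Cfg]. *)
have E := iter_findex conn; have := findex_max conn.
set k := findex _ _ _ in E *; move=> ltk.
have [|k' lek [E1 E2]] := represents_iter (k := k) run_start; first by rewrite E.
rewrite E /= in E1 E2.
have fin : (run machine w (k' + (size w).*2.+2).+1).1 = mhalt (s' 0 != 0).
  rewrite /run iterS iterD -/(run machine w _).
  case: (iter k' _ _) E1 E2 => q t /= -> E2.
  by rewrite /step /= ffunE E2 /= ffunE inordK ?cell_marker // ltnS.
have stay n (t : config machine) b : t.1 = mhalt b -> (iter n (@step _ machine) t).1 = mhalt b.
  move=> Et; elim: n => //= n; case: (iter _ _ _) => q t' /= ->.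
  by rewrite /step /halted /=; case: b {Et}.
have le_t : (k' + (size w).*2.+2).+1 <= mtime.
  rewrite /mtime -card_Cfg; have := leq_trans ltk (max_card _); lia.
rewrite /run -(subnK le_t) iterD; exact: stay.
Qed.

End Machine.

Lemma nat_poly (a e : nat) : exists p : {poly nat}, forall n,
  p.[n]%R = n + n + 3 + a * (n + 2) ^ e.
Proof.
have expE (m k : nat) : (m ^+ k)%R = m ^ k.
  by elim: k => // k IH; rewrite GRing.exprS IH expnS.
exists (('X + 'X + 3%N%:P + a%:P * ('X + 2%N%:P) ^+ e)%R) => n.
by rewrite !hornerE expE.
Qed.

Lemma mtime_poly c : exists p : {poly nat}, forall w, p.[size w]%R = mtime c w.
Proof.
have [p Ep] := nat_poly #|ctrl c|.+1 (regs c).+1.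
by exists p => w; rewrite Ep /mtime addn2 addn3 addnn.
Qed.

(** * Functions computed by heads *)

Lemma exec_ext w c (q : ctrl c) s s' s'' :
  exec w q s s' -> s' =1 s'' -> exec w q s s''.
Proof.
move=> ex; elim: ex s'' => {q s s'} [q s s' a E eqs|q q' s s1 s' a E eqs _ IH] s'' eqs'.
  by apply: ExecExit E _ => r; rewrite -eqs' eqs.
by apply: ExecStep E eqs _; apply: IH.
Qed.

Definition upd (s : store) (r v : nat) : store := fun r' => if r' == r then v else s r'.

Lemma upd_bounded w s r v : bounded w s -> v <= lim w -> bounded w (upd s r v).
Proof. by move=> bs lev r'; rewrite /upd; case: ifP. Qed.

Definition clear (r : nat) : cmd := While r marker (Dec r).

Lemma runs_clear w r s : runs w (clear r) s (upd s r 0).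
Proof.
have [n] := ubnP (s r); elim: n s => // n IH s ltn.
have [E|E] := posnP (s r).
  apply: (exec_ext (runs_while_stop (Dec r) _)); first by rewrite cell_marker E.
  by move=> r'; rewrite /upd; case: eqP => // ->.
apply: (@runs_while_loop _ _ _ _ _ (upd s r (s r).-1)).
- by rewrite cell_marker -lt0n.
- by apply: runs_dec; rewrite /upd ?eqxx // => r' /negPf->.
apply: (exec_ext (IH _ _)); first by rewrite /upd eqxx; lia.
by move=> r'; rewrite /upd; case: eqP.
Qed.

Definition move (a b : nat) : cmd := While a marker (Seq (Dec a) (Inc b)).

Lemma runs_move w a b s : a != b -> s b + s a <= lim w ->
  runs w (move a b) s (upd (upd s b (s b + s a)) a 0).
Proof.
move=> nab; have nba : (b == a) = false by rewrite eq_sym (negPf nab).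
have E := (eqxx, nba, negPf nab).
have [n] := ubnP (s a); elim: n s => // n IH s ltn le_l.
have [sa0|sa0] := posnP (s a).
  apply: (exec_ext (runs_while_stop _ _)); first by rewrite cell_marker sa0.
  by move=> r; rewrite /upd sa0 addn0; case: eqP => [->|_] //; case: eqP => [->|].
pose s1 := upd s a (s a).-1; pose s2 := upd s1 b (s b).+1.
apply: (@runs_while_loop _ _ _ _ _ s2).
- by rewrite cell_marker -lt0n.
- apply: (@runs_seq _ _ _ _ s1).
    by apply: runs_dec; rewrite /s1 /upd ?E // => r /negPf->.
  apply: runs_inc; rewrite /s2 /s1 /upd ?E; try lia.
  by move=> r /negPf->.
apply: (exec_ext (IH _ _ _)); rewrite /s2 /s1 /upd ?E; try lia.
by move=> r; case: eqP => // _; case: eqP => // _; lia.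
Qed.

Definition dup (a b d : nat) : cmd :=
  While a marker (Seq (Dec a) (Seq (Inc b) (Inc d))).

Lemma runs_dup w a b d s : uniq [:: a; b; d] ->
  s b + s a <= lim w -> s d + s a <= lim w ->
  runs w (dup a b d) s (upd (upd (upd s b (s b + s a)) d (s d + s a)) a 0).
Proof.
rewrite /= !inE negb_or andbT => /andP[/andP[nab nad] nbd].
have nba : (b == a) = false by rewrite eq_sym (negPf nab).
have nda : (d == a) = false by rewrite eq_sym (negPf nad).
have ndb : (d == b) = false by rewrite eq_sym (negPf nbd).
move/negPf in nab; move/negPf in nad; move/negPf in nbd.
have [n] := ubnP (s a); elim: n s => // n IH s ltn le_b le_d.
have [E|E] := posnP (s a).
  apply: (exec_ext (runs_while_stop _ _)); first by rewrite cell_marker E.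
  move=> r'; rewrite /upd E !addn0; case: eqP => [->|_] //.
  by case: eqP => [->|] //; case: eqP => [->|].
pose s1 := upd s a (s a).-1; pose s2 := upd s1 b (s b).+1.
apply: (@runs_while_loop _ _ _ _ _ (upd s2 d (s d).+1)).
- by rewrite cell_marker -lt0n.
- apply: (@runs_seq _ _ _ _ s1).
    by apply: runs_dec; rewrite /s1 /upd ?eqxx // => r' /negPf->.
  apply: (@runs_seq _ _ _ _ s2); apply: runs_inc;
    rewrite /s2 /s1 /upd ?eqxx ?nba ?nda ?ndb ?eqxx; try lia.
  + by move=> r' /negPf->.
  + by move=> r' /negPf->.
apply: (exec_ext (IH _ _ _ _)); rewrite /s2 /s1 /upd ?eqxx ?nab ?nad ?nba ?nda ?ndb ?nbd ?eqxx; try lia.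
by move=> r'; case: eqP => // _; case: eqP => [_|_]; [lia|case: eqP => // _; lia].
Qed.

(** Transferring the value of a register empties it. So the value goes to [b] and [t] at once, and
    [a] is restored from [t]. *)
Definition copy (a b t : nat) : cmd :=
  Seq (clear b) (Seq (clear t) (Seq (dup a b t) (move t a))).

Lemma runs_copy w a b t s : uniq [:: a; b; t] -> s a <= lim w ->
  runs w (copy a b t) s (upd (upd s b (s a)) t 0).
Proof.
move=> un le_a; have := un; rewrite /= !inE negb_or andbT => /andP[/andP[nab nat_] nbt].
have nba : (b == a) = false by rewrite eq_sym (negPf nab).
have nta : (t == a) = false by rewrite eq_sym (negPf nat_).
have ntb : (t == b) = false by rewrite eq_sym (negPf nbt).
move/negPf in nab; move/negPf in nat_; move/negPf in nbt.
apply: (runs_seq (runs_clear _ _ _)); apply: (runs_seq (runs_clear _ _ _)).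
have E := (nab, nat_, nba, nta, ntb, nbt, eqxx).
apply: (runs_seq (runs_dup un _ _)); rewrite ?/upd ?E ?add0n //.
apply: (exec_ext (runs_move _ _)); rewrite /upd ?E ?add0n //.
move=> r; case: eqP => // _; case: eqP => [->|_]; first by rewrite E.
by case: eqP.
Qed.

(* [rho] holds the arguments of [f]; the result goes to register [m], and only
   registers from [m] on may be modified. Words with at most two letters encode no
   instance; excluding them makes room for the constants up to [4]. *)
Definition computable (f : seq letter -> seq nat -> nat) : Prop :=
  forall (rho : seq nat) (m : nat), all (gtn m) rho ->
  exists c, forall w s, 2 < size w -> bounded w s ->
  exists s', [/\ runs w c s s', s' m = f w (map s rho),
    forall r, r < m -> s' r = s r & bounded w s'].

Definition small (w : seq letter) (xs : seq nat) : bool :=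
  (2 < size w) && all (geq (lim w)) xs.

Lemma computable_ext f g : computable g ->
  (forall w xs, small w xs -> f w xs = g w xs) -> computable f.
Proof.
move=> cg E rho m mrho; have [c cP] := cg rho m mrho; exists c => w s w2 bs.
have [s' [? Es' ? ?]] := cP w s w2 bs; exists s'; split=> //.
rewrite Es' E // /small w2 all_map; apply/allP=> r _ /=; apply: bs.
Qed.

(** The result is the position of a head, in a run whose first registers hold [xs]. *)
Lemma computable_le f w xs : computable f -> small w xs -> f w xs <= lim w.
Proof.
move=> cf /andP[w2 /allP sx].
have [|c cP] := cf (iota 0 (size xs)) (size xs).
  by apply/allP=> r; rewrite mem_iota.
pose s r := nth 0 xs r.
have bs : bounded w s.
  by move=> r; rewrite /s; case: (ltnP r (size xs)) => [/(mem_nth 0)/sx|/(nth_default 0)->].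
have [s' [_ E _ /(_ (size xs))]] := cP w s w2 bs.
by rewrite E map_nth_iota0 // take_size.
Qed.

Lemma eq_map_lt (s s' : store) m rho : all (gtn m) rho ->
  (forall r, r < m -> s' r = s r) -> map s' rho = map s rho.
Proof. by move=> /allP mrho E; apply/eq_in_map => r /mrho; apply: E. Qed.

Lemma computable_zero : computable (fun _ _ => 0).
Proof.
move=> rho m _; exists (clear m) => w s _ bs; exists (upd s m 0).
split; [exact: runs_clear|by rewrite /upd eqxx| |exact: upd_bounded].
by move=> r ltr; rewrite /upd ltn_eqF.
Qed.

Lemma computable_var i : computable (fun _ xs => nth 0 xs i).
Proof.
move=> rho m /allP mrho; case: (ltnP i (size rho)) => lti; last first.
  have [c cP] := computable_zero (rho := [::]) (m := m) isT.
  exists c => w s w2 bs; have [s' [? E ? ?]] := cP w s w2 bs.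
  by exists s'; split; rewrite // E nth_default ?size_map.
pose r := nth 0 rho i; have ltr : r < m by apply: mrho; apply: mem_nth.
exists (copy r m m.+1) => w s _ bs; exists (upd (upd s m (s r)) m.+1 0).
split.
- by apply: runs_copy => //=; rewrite !inE; lia.
- by rewrite /upd (nth_map 0) // eqxx -[m in _ == m](addn0) ltn_eqF // addn0.
- by move=> r' ltr'; rewrite /upd !ltn_eqF // ltnW.
- by apply: upd_bounded => //; apply: upd_bounded.
Qed.

Lemma computable_lim : computable (fun w _ => lim w).
Proof.
move=> rho m _; exists (While m None (Inc m)) => w s _ bs; exists (upd s m (lim w)).
split; [|by rewrite /upd eqxx| |exact: upd_bounded]; last first.
  by move=> r ltr; rewrite /upd ltn_eqF.
have [n] := ubnP (lim w - s m); elim: n s bs => // n IH s bs ltn.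
have [E|E] := eqVneq (s m) (lim w).
  apply: (exec_ext (runs_while_stop _ _)); first by rewrite cell_blank E.
  by move=> r; rewrite /upd; case: eqP => // ->.
have lt_l : s m < lim w by rewrite ltn_neqAle E bs.
apply: (@runs_while_loop _ _ _ _ _ (upd s m (s m).+1)).
- by rewrite cell_blank.
- apply: runs_inc => //; rewrite /upd ?eqxx; first by rewrite (minn_idPl lt_l).
  by move=> r /negPf->.
apply: (exec_ext (IH _ _ _)); first exact: upd_bounded.
- by rewrite /upd eqxx; lia.
by move=> r; rewrite /upd; case: eqP.
Qed.

Lemma computable_succ f : computable f ->
  computable (fun w xs => minn (f w xs).+1 (lim w)).
Proof.
move=> cf rho m mrho; have [c cP] := cf rho m mrho.
exists (Seq c (Inc m)) => w s w2 bs; have [s1 [ex E1 E2 bs1]] := cP w s w2 bs.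
exists (upd s1 m (minn (s1 m).+1 (lim w))); split.
- apply: runs_seq ex _; apply: runs_inc; rewrite /upd ?eqxx //.
  by move=> r /negPf->.
- by rewrite /upd eqxx E1.
- by move=> r ltr; rewrite /upd ltn_eqF // E2.
- by apply: upd_bounded; rewrite // geq_minr.
Qed.

Lemma computable_predn f : computable f -> computable (fun w xs => (f w xs).-1).
Proof.
move=> cf rho m mrho; have [c cP] := cf rho m mrho.
exists (Seq c (Dec m)) => w s w2 bs; have [s1 [ex E1 E2 bs1]] := cP w s w2 bs.
exists (upd s1 m (s1 m).-1); split.
- apply: runs_seq ex _; apply: runs_dec; rewrite /upd ?eqxx //.
  by move=> r /negPf->.
- by rewrite /upd eqxx E1.
- by move=> r ltr; rewrite /upd ltn_eqF // E2.
- by apply: upd_bounded => //; apply: leq_trans (leq_pred _) _.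
Qed.

Lemma computable_ifcell a f g h :
  computable f -> computable g -> computable h ->
  computable (fun w xs => if cell w (f w xs) == a then g w xs else h w xs).
Proof.
move=> cf cg ch rho m mrho; have [c cP] := cf rho m mrho.
have [c1 cP1] := cg rho m mrho; have [c2 cP2] := ch rho m mrho.
exists (Seq c (If m a c1 c2)) => w s w2 bs.
have [s0 [ex0 E0 E0' bs0]] := cP w s w2 bs.
have [s1 [ex1 E1 E1' bs1]] := cP1 w s0 w2 bs0.
have [s2 [ex2 E2 E2' bs2]] := cP2 w s0 w2 bs0.
have Er := eq_map_lt mrho E0'.
exists (if cell w (s0 m) == a then s1 else s2); split.
- by apply: runs_seq ex0 _; apply: runs_if; case: ifP.
- by rewrite -E0; case: ifP => _; rewrite ?E1 ?E2 Er.
- by move=> r ltr; case: ifP => _; rewrite ?E1' ?E2' // E0'.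
- by case: ifP.
Qed.

(** Argument lists are stacks of de Bruijn variables: a new value is pushed in front. *)
Lemma computable_let f g : computable f -> computable g ->
  computable (fun w xs => g w (f w xs :: xs)).
Proof.
move=> cf cg rho m mrho; have [c1 cP1] := cf rho m mrho.
have [|c2 cP2] := cg (m :: rho) m.+1.
  by rewrite /= leqnn; apply: sub_all mrho => r /= /leqW.
exists (Seq c1 (Seq c2 (Seq (clear m) (move m.+1 m)))) => w s w2 bs.
have [s1 [ex1 E1 E1' bs1]] := cP1 w s w2 bs.
have [s2 [ex2 E2 E2' bs2]] := cP2 w s1 w2 bs1.
have nm : (m.+1 == m) = false by rewrite gtn_eqF.
exists (upd (upd s2 m (s2 m.+1)) m.+1 0); split.
- apply: (runs_seq ex1); apply: (runs_seq ex2); apply: (runs_seq (runs_clear _ _ _)).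
  apply: (exec_ext (runs_move _ _)); rewrite /upd ?eqxx ?nm ?add0n //.
  by move=> r; case: eqP => //; case: eqP.
- by rewrite /upd eqxx ltn_eqF // E2 /= E1 (eq_map_lt mrho E1').
- by move=> r ltr; rewrite /upd !ltn_eqF ?E2' ?E1' // ltnW.
- by apply: upd_bounded => //; apply: upd_bounded.
Qed.

(** By naturality the rearrangement can act on the names of the registers instead of their contents,
    so it costs no instruction. *)
Lemma computable_reindex f (phi : forall T, seq T -> seq T) :
  (forall T U (h : T -> U) s, map h (phi T s) = phi U (map h s)) ->
  (forall s : seq nat, {subset phi nat s <= s}) ->
  computable f -> computable (fun w xs => f w (phi nat xs)).
Proof.
move=> nat_phi sub_phi cf rho m /allP mrho.
have [|c cP] := cf (phi nat rho) m; first by apply/allP=> r /sub_phi/mrho.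
by exists c => w s w2 bs; have := cP w s w2 bs; rewrite nat_phi.
Qed.

(** Register [m] holds the accumulator, [m.+1] the index of the round and [m.+2] the number of
    rounds left; [f] leaves its result in [m.+3], from where it is moved to [m]. *)
Lemma computable_iter b a f :
  computable b -> computable a -> computable f ->
  computable (fun w xs =>
    iteri (b w xs) (fun i acc => f w (i :: acc :: xs)) (a w xs)).
Proof.
move=> cb ca cf rho m mrho.
have [ka kaP] := ca rho m mrho.
have m2rho : all (gtn m.+2) rho by apply: sub_all mrho => r /= ?; lia.
have m3rho : all (gtn m.+3) [:: m.+1, m & rho].
  by apply/and3P; split; [move=> /=; lia|move=> /=; lia|apply: sub_all mrho => r /= ?; lia].
have [kb kbP] := cb rho m.+2 m2rho; have [kf kfP] := cf _ _ m3rho.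
pose body := Seq kf (Seq (clear m) (Seq (move m.+3 m) (Seq (Inc m.+1) (Dec m.+2)))).
exists (Seq ka (Seq (clear m.+1) (Seq kb (While m.+2 marker body)))) => w s w2 bs.
have [s1 [ex1 E1 E1' bs1]] := kaP w s w2 bs.
have bs2 : bounded w (upd s1 m.+1 0) by apply: upd_bounded.
have [s3 [ex3 E3 E3' bs3]] := kbP w _ w2 bs2.
have Er : map (upd s1 m.+1 0) rho = map s rho.
  by apply: (eq_map_lt mrho) => r ltr; rewrite /upd ltn_eqF ?E1' // ltnW.
set B := b w (map s rho); set F := fun i acc => f w [:: i, acc & map s rho].
have {}E3 : s3 m.+2 = B by rewrite E3 Er.
have leB : B <= lim w by rewrite -E3.
have loop n s4 : bounded w s4 -> s4 m.+2 = n -> n <= B -> s4 m.+1 = B - n ->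
    (forall r, r < m -> s4 r = s r) -> s4 m = iteri (B - n) F (a w (map s rho)) ->
    exists s5, [/\ runs w (While m.+2 marker body) s4 s5,
       s5 m = iteri B F (a w (map s rho)), forall r, r < m -> s5 r = s r & bounded w s5].
  elim: n s4 => [|n IH] s4 bs4 En leB' Em1 Elow Em.
    exists s4; split=> //; last by rewrite Em subn0.
    by apply: runs_while_stop; rewrite cell_marker En.
  have [s5 [ex5 E5 E5' bs5]] := kfP w s4 w2 bs4.
  have {}E5 : s5 m.+3 = F (B - n.+1) (s4 m).
    by rewrite E5 /= Em1 (eq_map_lt mrho Elow).
  have n1 : (m.+1 == m) = false by lia.
  have n2 : (m.+2 == m) = false by lia.
  have n3 : (m.+3 == m) = false by lia.
  have n4 : (m == m.+3) = false by lia.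
  have n5 : (m.+1 == m.+3) = false by lia.
  have n6 : (m.+2 == m.+3) = false by lia.
  have n7 : (m.+2 == m.+1) = false by lia.
  have n8 : (m == m.+1) = false by lia.
  have n9 : (m == m.+2) = false by lia.
  have n10 : (m.+1 == m.+2) = false by lia.
  have E := (eqxx, n1, n2, n3, n4, n5, n6, n7, n8, n9, n10).
  pose s6 := upd (upd (upd s5 m 0) m (s5 m.+3)) m.+3 0.
  pose s7 := upd s6 m.+1 (s5 m.+1).+1; pose s8 := upd s7 m.+2 (s5 m.+2).-1.
  have Es1 : s5 m.+1 = B - n.+1 by rewrite E5'.
  have Es2 : s5 m.+2 = n.+1 by rewrite E5'.
  have ex : runs w body s4 s8.
    apply: (runs_seq ex5); apply: (runs_seq (runs_clear _ _ _)).
    apply: (@runs_seq _ _ _ _ s6).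
      apply: (exec_ext (runs_move _ _)); rewrite ?n3 // /upd ?E ?add0n //.
    apply: (@runs_seq _ _ _ _ s7).
      apply: runs_inc; rewrite /s7 /s6 /upd ?E //; first by lia.
      by move=> r /negPf->.
    apply: runs_dec; rewrite /s8 /s7 /s6 /upd ?E //.
    by move=> r /negPf->.
  have bs8 : bounded w s8.
    by do ![apply: upd_bounded => //]; rewrite ?Es1 ?Es2; lia.
  have [|||r ltr||s9 [ex9 E9 E9' bs9]] := IH s8 bs8.
  - by rewrite /s8 /upd eqxx Es2.
  - exact: ltnW.
  - by rewrite /s8 /s7 /upd ?E Es1; lia.
  - rewrite /s8 /s7 /s6 /upd !ltn_eqF; try lia.
    by rewrite E5' ?Elow //; lia.
  - rewrite /s8 /s7 /s6 /upd ?E E5 Em.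
    by have -> : B - n = (B - n.+1).+1 by lia.
  exists s9; split=> //; apply: runs_while_loop ex ex9.
  by rewrite cell_marker En.
have [|r ltr||s5 [ex5 E5 E5' bs5]] := loop B s3 bs3 E3 (leqnn B).
- by rewrite E3' // /upd eqxx subnn.
- by rewrite E3' ?/upd ?ltn_eqF ?E1' //; lia.
- by rewrite E3' ?/upd ?subnn ?ltn_eqF //; lia.
exists s5; split=> //.
by apply: (runs_seq ex1); apply: (runs_seq (runs_clear _ _ _)); apply: (runs_seq ex3).
Qed.

Lemma computable_decides f : computable f ->
  exists M (p : {poly nat}), forall w, 2 < size w ->
    (f w [::] != 0 -> accepts_within (M : turing_machine letter) w p.[size w]%R) /\
    (f w [::] = 0 -> rejects_within M w p.[size w]%R).
Proof.
move=> cf; have [c cP] := cf [::] 0 isT; have [p Ep] := mtime_poly c.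
exists (machine c), p => w w2.
have [s' [ex E _ bs']] := cP w (fun=> 0) w2 (fun=> leq0n _).
rewrite /accepts_within /rejects_within Ep (run_machine ex bs') E /=.
by split=> [->|->].
Qed.

(** * Bounded quantifiers and reading the input *)

Lemma small_lim w xs : small w xs -> 3 < lim w.
Proof. by case/andP. Qed.

Lemma computable_const k : k <= 4 -> computable (fun _ _ => k).
Proof.
elim: k => [_|k IH ltk]; first exact: computable_zero.
apply: computable_ext (computable_succ (IH (ltnW ltk))) _ => w xs /small_lim ltl.
by rewrite (minn_idPl _) //; lia.
Qed.

Definition testable (P : seq letter -> seq nat -> bool) :=
  computable (fun w xs => nat_of_bool (P w xs)).

Lemma computable_if P f g : testable P -> computable f -> computable g ->
  computable (fun w xs => if P w xs then f w xs else g w xs).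
Proof.
move=> tP cf cg; apply: computable_ext (computable_ifcell marker tP cg cf) _ => w xs _.
by rewrite cell_marker; case: (P w xs).
Qed.

Lemma testable_ext P Q : testable Q -> (forall w xs, small w xs -> P w xs = Q w xs) ->
  testable P.
Proof. by move=> tQ E; apply: computable_ext tQ _ => w xs sx; rewrite E. Qed.

Lemma testable_const b : testable (fun _ _ => b).
Proof. by apply: computable_const; case: b. Qed.

Lemma testable_if P Q R : testable P -> testable Q -> testable R ->
  testable (fun w xs => if P w xs then Q w xs else R w xs).
Proof.
move=> tP tQ tR; apply: computable_ext (computable_if tP tQ tR) _ => w xs _.
by case: (P w xs).
Qed.

Lemma testable_neg P : testable P -> testable (fun w xs => ~~ P w xs).
Proof. by move=> tP; apply: (testable_if tP (testable_const false) (testable_const true)). Qed.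

Lemma testable_and P Q : testable P -> testable Q ->
  testable (fun w xs => P w xs && Q w xs).
Proof. by move=> tP tQ; apply: (testable_if tP tQ (testable_const false)). Qed.

Lemma testable_or P Q : testable P -> testable Q ->
  testable (fun w xs => P w xs || Q w xs).
Proof. by move=> tP tQ; apply: (testable_if tP (testable_const true) tQ). Qed.

Lemma computable_sub f g : computable f -> computable g ->
  computable (fun w xs => f w xs - g w xs).
Proof.
move=> cf cg.
apply: computable_ext (computable_iter cg cf (computable_predn (computable_var 1))) _.
move=> w xs _; elim: (g w xs) => [|n IH] /=; first exact: subn0.
by rewrite subnS IH.
Qed.

Lemma testable_leq f g : computable f -> computable g ->
  testable (fun w xs => f w xs <= g w xs).
Proof.
move=> cf cg; have cs := computable_sub cf cg.
apply: computable_ext (computable_ifcell marker cs (testable_const true) (testable_const false)) _.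
by move=> w xs _; rewrite cell_marker subn_eq0; case: leqP.
Qed.

Lemma testable_eq f g : computable f -> computable g ->
  testable (fun w xs => f w xs == g w xs).
Proof.
move=> cf cg; apply: testable_ext (testable_and (testable_leq cf cg) (testable_leq cg cf)) _.
by move=> w xs _; rewrite eqn_leq.
Qed.

Lemma computable_add f g : computable f -> computable g ->
  computable (fun w xs => minn (f w xs + g w xs) (lim w)).
Proof.
move=> cf cg.
apply: computable_ext (computable_iter cg cf (computable_succ (computable_var 1))) _.
move=> w xs sx; have := computable_le cf sx; elim: (g w xs) => [|n IH] le_f /=.
  by rewrite addn0 (minn_idPl le_f).
by rewrite -IH //; lia.
Qed.

Lemma computable_drop k f : computable f -> computable (fun w xs => f w (drop k xs)).
Proof.
apply: (@computable_reindex f (fun T => @drop T k)) => [T U h s|s x].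
  by rewrite map_drop.
exact: mem_drop.
Qed.

Lemma testable_has P b : testable P -> computable b ->
  testable (fun w xs => has (fun i => P w (i :: xs)) (iota 0 (b w xs))).
Proof.
move=> tP cb.
(* In the loop the arguments are the index, the accumulator and [xs]; the rearrangement hides the
   accumulator from [P]. *)
have tP' : testable (fun w xs => P w (take 1 xs ++ drop 2 xs)).
  apply: (@computable_reindex _ (fun T s => take 1 s ++ drop 2 s)) tP => [T U h s|s x].
    by rewrite map_cat map_take map_drop.
  by rewrite mem_cat => /orP[/mem_take|/mem_drop].
have := computable_iter cb computable_zero
  (computable_if tP' (computable_const (isT : 1 <= 4)) (computable_var 1)).
move=> ci; apply: computable_ext ci _ => w xs _.
elim: (b w xs) => [//|n IH]; rewrite -addn1 iotaD has_cat /= orbF addn1 /= -IH.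
by rewrite drop0; case: (P _ _); rewrite ?orbT ?orbF.
Qed.

Lemma computable_count P b : testable P -> computable b ->
  computable (fun w xs => count (fun i => P w (i :: xs)) (iota 0 (b w xs))).
Proof.
move=> tP cb.
have tP' : testable (fun w xs => P w (take 1 xs ++ drop 2 xs)).
  apply: (@computable_reindex _ (fun T s => take 1 s ++ drop 2 s)) tP => [T U h s|s x].
    by rewrite map_cat map_take map_drop.
  by rewrite mem_cat => /orP[/mem_take|/mem_drop].
have := computable_iter cb computable_zero
  (computable_if tP' (computable_succ (computable_var 1)) (computable_var 1)).
move=> ci; apply: computable_ext ci _ => w xs sx.
have := computable_le cb sx; elim: (b w xs) => [//|n IH] ltn.
rewrite -addn1 iotaD count_cat /= addn0 addn1 /= -IH ?drop0; last exact: ltnW.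
rewrite IH; last exact: ltnW.
have := count_size (fun i => P w (i :: xs)) (iota 0 n); rewrite size_iota add0n => le_n.
by case: (P _ _); rewrite ?addn0 ?addn1 //; apply/esym/minn_idPl; lia.
Qed.

Lemma testable_all P b : testable P -> computable b ->
  testable (fun w xs => all (fun i => P w (i :: xs)) (iota 0 (b w xs))).
Proof.
move=> tP cb; apply: testable_ext (testable_neg (testable_has (testable_neg tP) cb)) _.
by move=> w xs _; rewrite has_predC negbK.
Qed.

(** The list [l] is fixed with the program, so the disjunction is unrolled. This is needed for
    [linked]: an index computed during the run could not select a register. *)
Lemma testable_has_seq (P : nat -> seq letter -> seq nat -> bool) l :
  (forall i, testable (P i)) -> testable (fun w xs => has (fun i => P i w xs) l).
Proof.
by move=> tP; elim: l => [|i l IH]; [exact: testable_const|exact: testable_or].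
Qed.

(** The guess: [k] does not depend on the input, so this is a fixed nest of [k] loops, whose
    variables end up in front of [xs]. *)
Fixpoint somes k (P : seq letter -> seq nat -> bool) w xs : bool :=
  if k is k'.+1 then has (fun i => somes k' P w (i :: xs)) (iota 0 (lim w))
  else P w xs.

Lemma testable_somes k P : testable P -> testable (somes k P).
Proof. by move=> tP; elim: k => [//|k IH]; apply: testable_has IH computable_lim. Qed.

Lemma somesP k (P : seq letter -> seq nat -> bool) w xs : reflect
  (exists ys, [/\ size ys = k, all (gtn (lim w)) ys & P w (ys ++ xs)])
  (somes k P w xs).
Proof.
elim: k xs => [|k IH] xs.
  apply: (iffP idP) => [Pxs|[ys [/size0nil -> //]]]; by exists [::].
apply: (iffP (@hasP _ (fun i => somes k P w (i :: xs)) (iota 0 (lim w))))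
  => [[i] | [ys [sy ay Py]]].
  rewrite mem_iota add0n => /= lti /IH[ys [sy ay Py]]; exists (rcons ys i).
  by split; rewrite ?size_rcons ?sy ?all_rcons ?ay ?andbT ?cat_rcons.
case/lastP: ys sy ay Py => [//|ys i]; rewrite size_rcons all_rcons cat_rcons.
move=> [sy] /andP[lti ay] Py; exists i; first by rewrite mem_iota.
by apply/IH; exists ys.
Qed.

Lemma computable_args f gs :
  (forall i, i < size gs -> computable (nth (fun _ _ => 0) gs i)) ->
  computable f -> computable (fun w xs => f w ([seq g w xs | g <- gs] ++ xs)).
Proof.
elim: gs f => [//|g gs IH] f cgs cf.
have cf' : computable (fun w xs => f w (g w (drop (size gs) xs) :: xs)).
  exact: computable_let (computable_drop (size gs) (cgs 0 isT)) cf.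
apply: computable_ext (IH _ (fun i => cgs i.+1) cf') _ => w xs _.
by rewrite drop_size_cat // size_map.
Qed.

(** Meant for an [F] that has the guessed list as a parameter: under [k] quantifiers, this list is
    what remains of the stack after its first [k] entries. *)
Lemma computable_comp1 (F : seq letter -> seq nat -> nat -> nat) k f :
  computable (fun w xs => F w (drop 1 xs) (nth 0 xs 0)) -> computable f ->
  computable (fun w xs => F w (drop k xs) (f w xs)).
Proof.
move=> cF cf.
have cF' : computable (fun w xs => F w (drop k (drop 1 xs)) (nth 0 xs 0)).
  have := @computable_reindex _ (fun T (s : seq T) => take 1 s ++ drop k (drop 1 s)) _ _ cF.
  move=> H; apply: computable_ext (H _ _) _ => [T U h s|s x|w [|x xs] _].
  - by rewrite map_cat map_take !map_drop.
  - by rewrite mem_cat => /orP[/mem_take//|/mem_drop/mem_drop].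
  - by [].
  - by rewrite /= take0 /= !drop0.
apply: computable_ext (computable_let cf cF') _ => w xs _; by rewrite /= drop0.
Qed.

Lemma computable_comp2 (F : seq letter -> seq nat -> nat -> nat -> nat) k f g :
  computable (fun w xs => F w (drop 2 xs) (nth 0 xs 0) (nth 0 xs 1)) ->
  computable f -> computable g ->
  computable (fun w xs => F w (drop k xs) (f w xs) (g w xs)).
Proof.
move=> cF cf cg.
have cF' : computable (fun w xs =>
    F w (drop k (drop 2 xs)) (nth 0 xs 0) (nth 0 xs 1)).
  have := @computable_reindex _ (fun T (s : seq T) => take 2 s ++ drop k (drop 2 s)) _ _ cF.
  move=> H; apply: computable_ext (H _ _) _ => [T U h s|s x|w [|x [|y xs]] _] //.
  - by rewrite map_cat map_take !map_drop.
  - by rewrite mem_cat => /orP[/mem_take//|/mem_drop/mem_drop].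
  - by rewrite /= take0 /= !drop0.
have cgs i : i < 2 -> computable (nth (fun _ _ => 0) [:: f; g] i) by case: i => [|[]].
apply: computable_ext (computable_args (gs := [:: f; g]) cgs cF') _ => w xs _; by rewrite /= drop0.
Qed.

Lemma computable_comp3 (F : seq letter -> nat -> nat -> nat -> nat) f g h :
  computable (fun w xs => F w (nth 0 xs 0) (nth 0 xs 1) (nth 0 xs 2)) ->
  computable f -> computable g -> computable h ->
  computable (fun w xs => F w (f w xs) (g w xs) (h w xs)).
Proof.
move=> cF cf cg ch.
have cgs i : i < 3 -> computable (nth (fun _ _ => 0) [:: f; g; h] i) by case: i => [|[|[]]].
by apply: computable_ext (computable_args (gs := [:: f; g; h]) cgs cF) _ => w xs _.
Qed.

(** * Scanning the encoding from a given position *)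

Definition reads (a : letter) (w : seq letter) (i : nat) : bool :=
  nth None (map some w) i == Some a.

Lemma testable_reads a f : computable f -> testable (fun w xs => reads a w (f w xs)).
Proof.
move=> cf; apply: computable_ext (computable_ifcell (Some (inl a)) (computable_succ cf)
  (testable_const true) (testable_const false)) _ => w xs _.
rewrite /reads -cell_letter; set i := f w xs.
have [lti|lti] := ltnP i (lim w); first by rewrite (minn_idPl lti); case: ifP.
have -> : cell w (minn i.+1 (lim w)) = None.
  by apply/eqP; rewrite (minn_idPr (leqW lti)) cell_blank.
by rewrite cell_letter nth_default // size_map; apply: ltnW.
Qed.

Definition digit w i := reads (Some true) w i || reads (Some false) w i.

Lemma testable_digit f : computable f -> testable (fun w xs => digit w (f w xs)).
Proof. by move=> cf; apply: testable_or; apply: testable_reads. Qed.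

(* The states are: 0 in the unary header, 1 in the budget, 2 where an edge or
   the end of a hedge is expected, 3 in the first endpoint of an edge, and 4 in
   the second one. *)
Definition next_phase w i q : nat :=
  if reads sep w i then
    (if q == 0 then 1 else if q == 1 then 2 else if q == 3 then 4 else 2)
  else if q == 2 then 3 else q.

Definition phase w p : nat := iteri p (next_phase w) 0.

Lemma computable_phase f : computable f -> computable (fun w xs => phase w (f w xs)).
Proof.
move=> cf; have c k (lek : k <= 4) := computable_const lek.
have tq k (lek : k <= 4) := testable_eq (computable_var 1) (c k lek).
exact: (computable_iter cf computable_zero (f := fun w xs => next_phase w (nth 0 xs 0) (nth 0 xs 1))
 (computable_if (testable_reads sep (computable_var 0))
   (computable_if (tq 0 isT) (c 1 isT) (computable_if (tq 1 isT) (c 2 isT)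
      (computable_if (tq 3 isT) (c 4 isT) (c 2 isT))))
   (computable_if (tq 2 isT) (c 3 isT) (computable_var 1)))).
Qed.

(** The least significant digit comes first, so reading backwards amounts to Horner's scheme. *)
Definition numeral_step w i acc : nat :=
  if digit w i then minn (minn (acc + acc) (lim w) + reads (Some true) w i) (lim w)
  else 0.

(* The number whose binary expansion starts at position [p], truncated to [lim w];
   reading backwards from the end of the word, each separator resets it. *)
Definition numeral w p : nat :=
  iteri ((lim w).-1 - p) (fun i acc => numeral_step w ((lim w).-1 - i.+1) acc) 0.

Definition nxt_step w i acc : nat := if reads sep w i then i.+1 else acc.

(* The position after the first separator at or after [p]. *)
Definition nxt w p : nat :=
  iteri ((lim w).-1 - p) (fun i acc => nxt_step w ((lim w).-1 - i.+1) acc) 0.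

Lemma computable_backwards (F : seq letter -> nat -> nat -> nat) f :
  computable (fun w xs => F w (nth 0 xs 0) (nth 0 xs 1)) -> computable f ->
  computable (fun w xs =>
    iteri ((lim w).-1 - f w xs) (fun i acc => F w ((lim w).-1 - i.+1) acc) 0).
Proof.
move=> cF cf; have cl := computable_predn computable_lim.
have cb := computable_sub cl cf.
have ci := computable_predn (computable_sub cl (computable_var 0)).
have := computable_comp2 (F := fun w _ => F w) 0 cF ci (computable_var 1).
move/(computable_iter cb computable_zero) => cI.
apply: computable_ext cI _ => w xs _; elim: (_ - _) => //= n ->.
by rewrite subnS.
Qed.

Lemma computable_numeral f : computable f -> computable (fun w xs => numeral w (f w xs)).
Proof.
apply: computable_backwards.
apply: computable_if computable_zero; first exact: testable_digit (computable_var 0).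
apply: computable_add; last exact: testable_reads (computable_var 0).
by apply: computable_add; apply: computable_var.
Qed.

Lemma computable_nxt f : computable f -> computable (fun w xs => nxt w (f w xs)).
Proof.
apply: computable_backwards.
have c0 := computable_var 0.
apply: computable_ext (computable_if (testable_reads sep c0) (computable_succ c0)
  (computable_var 1)) _ => w xs _.
rewrite /nxt_step; case: ifP => // rd; apply/esym/minn_idPl.
move: rd; rewrite /reads; case: (ltnP (nth 0 xs 0) (size w)) => [lt _|ge]; first exact: ltnW.
by rewrite nth_default ?size_map.
Qed.

(** * The search *)

Lemma testable_ex P : testable P ->
  testable (fun w xs => has (fun i => P w (i :: xs)) (iota 0 (lim w))).
Proof. by move=> tP; apply: testable_has computable_lim. Qed.

Lemma testable_forall P : testable P ->
  testable (fun w xs => all (fun i => P w (i :: xs)) (iota 0 (lim w))).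
Proof. by move=> tP; apply: testable_all computable_lim. Qed.

Definition hedge_end w p : bool := (phase w p == 2) && reads sep w p.
Definition edge_start w p : bool := (phase w p == 2) && digit w p.

(* The index of the hedge whose code contains position [p]. *)
Definition rank w p : nat := count (hedge_end w) (iota 0 p).

Definition edge w u v j : bool :=
  has (fun p => [&& edge_start w p, rank w p == j
        & (numeral w p == u) && (numeral w (nxt w p) == v)
          || (numeral w p == v) && (numeral w (nxt w p) == u)]) (iota 0 (lim w)).

Lemma testable_hedge_end f : computable f -> testable (fun w xs => hedge_end w (f w xs)).
Proof.
move=> cf; apply: testable_and (testable_reads sep cf).
exact: testable_eq (computable_phase cf) (computable_const _).
Qed.

Lemma testable_edge_start f : computable f -> testable (fun w xs => edge_start w (f w xs)).
Proof.
move=> cf; apply: testable_and (testable_digit cf).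
exact: testable_eq (computable_phase cf) (computable_const _).
Qed.

Lemma computable_rank f : computable f -> computable (fun w xs => rank w (f w xs)).
Proof.
exact: (computable_count (P := fun w xs => hedge_end w (nth 0 xs 0))
  (testable_hedge_end (computable_var 0))).
Qed.

Lemma testable_edge f g h : computable f -> computable g -> computable h ->
  testable (fun w xs => edge w (f w xs) (g w xs) (h w xs)).
Proof.
apply: (computable_comp3 (F := fun w u v j => nat_of_bool (edge w u v j))).
have c0 := computable_var 0; have cv := computable_numeral c0.
have cv' := computable_numeral (computable_nxt c0).
apply: (testable_ex (P := fun w xs => [&& edge_start w (nth 0 xs 0),
   rank w (nth 0 xs 0) == nth 0 xs 3
   & (numeral w (nth 0 xs 0) == nth 0 xs 1) && (numeral w (nxt w (nth 0 xs 0)) == nth 0 xs 2)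
  || (numeral w (nth 0 xs 0) == nth 0 xs 2) && (numeral w (nxt w (nth 0 xs 0)) == nth 0 xs 1)])).
apply: testable_and; first exact: testable_edge_start.
apply: testable_and; first exact: testable_eq (computable_rank c0) (computable_var 3).
by apply: testable_or; apply: testable_and; apply: testable_eq => //; apply: computable_var.
Qed.

(* [ts] is the concatenation of [d] pairs. *)
Definition linked d (ts : seq nat) u v : bool :=
  has (fun i => (nth 0 ts i.*2 == u) && (nth 0 ts i.*2.+1 == v)) (iota 0 d).

(** [linked d ts u u] expresses that [u] lies in one of the guessed clusters, and [linked d ts u v]
    that [v] lies in the same one. *)
Definition cut d w ts j : bool :=
  has (fun v => has (fun u => [&& edge w u v j, linked d ts u u & ~~ linked d ts u v])
    (iota 0 (lim w))) (iota 0 (lim w)).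

Definition kept d w ts u v : bool :=
  has (fun j => edge w u v j && ~~ cut d w ts j) (iota 0 (lim w)).

(** The budget begins after the separator that ends the unary header, at [nxt w 0]. The triple
    quantifier is the transitivity that characterizes disjoint unions of cliques. *)
Definition good d w ts : bool :=
  (count (cut d w ts) (iota 0 (lim w)) <= numeral w (nxt w 0)) &&
  all (fun x => all (fun v => all (fun u =>
    [|| u == x, ~~ kept d w ts u v, ~~ kept d w ts v x | kept d w ts u x])
    (iota 0 (lim w))) (iota 0 (lim w))) (iota 0 (lim w)).

Lemma testable_linked d k f g : computable f -> computable g ->
  testable (fun w xs => linked d (drop k xs) (f w xs) (g w xs)).
Proof.
apply: (computable_comp2 (F := fun w ts u v => nat_of_bool (linked d ts u v))).
have ct i : computable (fun _ xs => nth 0 (drop 2 xs) i).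
  exact: (computable_drop 2 (f := fun _ xs => nth 0 xs i) (computable_var i)).
apply: (testable_has_seq (P := fun i _ xs => (nth 0 (drop 2 xs) i.*2 == nth 0 xs 0)
  && (nth 0 (drop 2 xs) i.*2.+1 == nth 0 xs 1))) => i.
by apply: testable_and; apply: testable_eq => //; apply: computable_var.
Qed.

Lemma testable_cut d k f : computable f ->
  testable (fun w xs => cut d w (drop k xs) (f w xs)).
Proof.
apply: (computable_comp1 (F := fun w ts j => nat_of_bool (cut d w ts j))).
apply: (testable_ex (P := fun w xs => has (fun u => [&& edge w u (nth 0 xs 0) (nth 0 xs 1),
   linked d (drop 2 xs) u u & ~~ linked d (drop 2 xs) u (nth 0 xs 0)]) (iota 0 (lim w)))).
apply: (testable_ex (P := fun w xs => [&& edge w (nth 0 xs 0) (nth 0 xs 1) (nth 0 xs 2),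
   linked d (drop 3 xs) (nth 0 xs 0) (nth 0 xs 0)
   & ~~ linked d (drop 3 xs) (nth 0 xs 0) (nth 0 xs 1)])).
apply: testable_and; first by apply: testable_edge; apply: computable_var.
by apply: testable_and; last apply: testable_neg; apply: testable_linked; apply: computable_var.
Qed.

Lemma testable_kept d k f g : computable f -> computable g ->
  testable (fun w xs => kept d w (drop k xs) (f w xs) (g w xs)).
Proof.
apply: (computable_comp2 (F := fun w ts u v => nat_of_bool (kept d w ts u v))).
apply: (testable_ex (P := fun w xs =>
  edge w (nth 0 xs 1) (nth 0 xs 2) (nth 0 xs 0) && ~~ cut d w (drop 3 xs) (nth 0 xs 0))).
apply: testable_and; first by apply: testable_edge; apply: computable_var.
by apply: testable_neg; apply: testable_cut; apply: computable_var.
Qed.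

Lemma testable_good d : testable (good d).
Proof.
apply: (@testable_ext _ (fun w xs => good d w (drop 0 xs))); last first.
  by move=> w xs _; rewrite drop0.
apply: testable_and.
  apply: testable_leq; last exact: computable_numeral (computable_nxt computable_zero).
  apply: (computable_count (P := fun w xs => cut d w (drop 1 xs) (nth 0 xs 0)) _ computable_lim).
  by apply: testable_cut; apply: computable_var.
apply: (testable_forall (P := fun w xs => all (fun v => all (fun u =>
    [|| u == nth 0 xs 0, ~~ kept d w (drop 1 xs) u v, ~~ kept d w (drop 1 xs) v (nth 0 xs 0)
      | kept d w (drop 1 xs) u (nth 0 xs 0)])
    (iota 0 (lim w))) (iota 0 (lim w)))).
apply: (testable_forall (P := fun w xs => all (fun u =>
    [|| u == nth 0 xs 1, ~~ kept d w (drop 2 xs) u (nth 0 xs 0),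
      ~~ kept d w (drop 2 xs) (nth 0 xs 0) (nth 0 xs 1)
      | kept d w (drop 2 xs) u (nth 0 xs 1)])
    (iota 0 (lim w)))).
apply: (testable_forall (P := fun w xs =>
    [|| nth 0 xs 0 == nth 0 xs 2, ~~ kept d w (drop 3 xs) (nth 0 xs 0) (nth 0 xs 1),
      ~~ kept d w (drop 3 xs) (nth 0 xs 1) (nth 0 xs 2)
      | kept d w (drop 3 xs) (nth 0 xs 0) (nth 0 xs 2)])).
have c i := computable_var i.
apply: testable_or; first exact: testable_eq.
apply: testable_or; first exact: testable_neg (testable_kept _ _ _ _).
apply: testable_or; first exact: testable_neg (testable_kept _ _ _ _).
exact: testable_kept.
Qed.

(** * Parsing an encoded instance *)

Definition bits (m : nat) : seq bool :=
  [seq odd (m %/ 2 ^ i) | i <- iota 0 (trunc_log 2 m).+1].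

Definition decode (bs : seq bool) : nat := foldr (fun (b : bool) a => a + a + b) 0 bs.

Lemma binaryE m : binary m = map some (bits m).
Proof. by rewrite -map_comp. Qed.

Lemma bitsK m : decode (bits m) = m.
Proof.
rewrite /bits; move: (trunc_log_ltn m (isT : 1 < 2)).
move: (trunc_log 2 m).+1 => l; elim: l m => [|l IH] m ltm; first by case: m ltm.
rewrite /= expn0 divn1 -[1]addn0 iotaDl -map_comp.
rewrite (@eq_map _ _ _ (fun i => odd (m %/ 2 %/ 2 ^ i))); last first.
  by move=> i /=; rewrite -divnMA -expnS.
by rewrite IH ?divn2; [rewrite addnn addnC odd_double_half|rewrite expnS in ltm; lia].
Qed.

Section Scan.
Variable w : seq letter.

Lemma drop_lt T (s : seq T) p x y : drop p s = x :: y -> p < size s.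
Proof. by move=> E; rewrite ltnNge; apply/negP=> /drop_oversize; rewrite E. Qed.

Lemma drop_succ T (s : seq T) p x y : drop p s = x :: y -> drop p.+1 s = y.
Proof. by move=> E; rewrite -addn1 addnC -drop_drop E /= drop0. Qed.

Lemma drop_add T (s : seq T) p x y : drop p s = x ++ y -> drop (p + size x) s = y.
Proof. by move=> E; rewrite addnC -drop_drop E drop_size_cat. Qed.

Lemma readsE a p x y : drop p w = x :: y -> reads a w p = (x == a).
Proof.
move=> E; rewrite /reads -[p]addn0 -nth_drop -map_drop E /=.
by rewrite (inj_eq (@Some_inj _)).
Qed.

Lemma digitE p b y : drop p w = Some b :: y -> digit w p.
Proof. by move=> E; rewrite /digit !(readsE _ E); case: b E. Qed.

Lemma digit_sep p y : drop p w = sep :: y -> digit w p = false.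
Proof. by move=> E; rewrite /digit !(readsE _ E). Qed.

(** Turns a backward loop into a recursion on the suffix of the word at [p], the form suited to
    induction on the encoded data. *)
Lemma backwardsE (F : nat -> nat -> nat) p : p < size w ->
  iteri ((lim w).-1 - p) (fun i acc => F ((lim w).-1 - i.+1) acc) 0 =
  F p (iteri ((lim w).-1 - p.+1) (fun i acc => F ((lim w).-1 - i.+1) acc) 0).
Proof.
move=> ltp; have -> : (lim w).-1 - p = ((lim w).-1 - p.+1).+1 by exact/esym/subnSK.
by rewrite iteriS subnSK // subKn //; apply: ltnW.
Qed.

(** Truncating the tail first changes nothing: doubling and adding a digit never decrease a number,
    so a value that has reached [lim w] stays there. *)
Lemma numeral_bits bs p y : drop p w = map some bs ++ sep :: y ->
  numeral w p = minn (decode bs) (lim w).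
Proof.
elim: bs p => [|b bs IH] p /= E; rewrite /numeral backwardsE ?(drop_lt E) //;
  rewrite /numeral_step; first by rewrite (digit_sep E) min0n.
rewrite (digitE E) -/(numeral w _) (IH _ (drop_succ E)) (readsE _ E).
by case: b E => _ /=; lia.
Qed.

Lemma nxt_bits bs p y : drop p w = map some bs ++ sep :: y ->
  nxt w p = (p + size bs).+1.
Proof.
elim: bs p => [|b bs IH] p /= E; rewrite /nxt backwardsE ?(drop_lt E) //;
  rewrite /nxt_step (readsE _ E) /=; first by rewrite addn0.
by rewrite -/(nxt w _) (IH _ (drop_succ E)) addSnnS.
Qed.

Definition info p := (rank w p, numeral w p, numeral w (nxt w p)).

(** All that the search learns from the part of the word from [p] on: for each edge, the index of
    its hedge and its two endpoints. *)
Definition starts p := [seq info i | i <- iota p (size w - p) & edge_start w i].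

Lemma startsE p : p < size w ->
  starts p = if edge_start w p then info p :: starts p.+1 else starts p.+1.
Proof.
move=> ltp; rewrite /starts; have -> : size w - p = (size w - p.+1).+1 by lia.
by rewrite /=; case: ifP.
Qed.

Lemma rankE p : rank w p.+1 = rank w p + hedge_end w p.
Proof. by rewrite /rank -addn1 iotaD count_cat /= addn0. Qed.

Lemma phaseE p : phase w p.+1 = next_phase w p (phase w p).
Proof. by []. Qed.

(** Serves for the unary header, the budget and the digits of endpoints, where the scanner only has
    to pass. *)
Lemma scan_bits bs p y : drop p w = map some bs ++ y -> phase w p != 2 ->
  [/\ phase w (p + size bs) = phase w p, rank w (p + size bs) = rank w p,
      starts (p + size bs) = starts p & drop (p + size bs) w = y].
Proof.
elim: bs p => [|b bs IH] p /= E ne2; first by rewrite addn0; split.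
have Ep : phase w p.+1 = phase w p.
  by rewrite phaseE /next_phase (readsE _ E) /= (negPf ne2).
have := IH _ (drop_succ E); rewrite Ep addSnnS => /(_ ne2)[-> -> -> ->].
rewrite rankE /hedge_end (negPf ne2) addn0; split=> //.
by rewrite [in RHS]startsE ?(drop_lt E) // /edge_start (negPf ne2).
Qed.

Lemma scan_edge n (e : 'I_n * 'I_n) p y : n < lim w ->
  drop p w = edge_code e ++ y -> phase w p = 2 ->
  [/\ phase w (p + size (edge_code e)) = 2, 
      rank w (p + size (edge_code e)) = rank w p,
      starts p = (rank w p, val e.1, val e.2) :: starts (p + size (edge_code e))
    & drop (p + size (edge_code e)) w = y].
Proof.
case: e => u v ltn E0 p2.
have D := drop_add E0.
rewrite /edge_code /fst /snd !binaryE -catA cat_cons cat_rcons in E0.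
have E := E0.
have minE (i : 'I_n) : minn i (lim w) = i.
  by apply/minn_idPl; apply: ltnW; apply: ltn_trans ltn.
have Eu : numeral w p = u by rewrite (numeral_bits E) bitsK minE.
have En := nxt_bits E.
have E' := E; rewrite -cat_rcons in E'.
have Dv := drop_add E'; rewrite size_rcons size_map addnS -En in Dv.
have Ev : numeral w (nxt w p) = v by rewrite (numeral_bits Dv) bitsK minE.
(* The first digit of an edge is read in phase 2 and marks its start, so it is split off; it exists
   because 0 also has a digit. *)
have bu : bits u = odd u :: behead (bits u) by rewrite /bits /= expn0 divn1.
have Es : edge_start w p by rewrite bu in E; rewrite /edge_start p2 (digitE E).
rewrite bu cat_cons in E.
have p3 : phase w p.+1 = 3 by rewrite phaseE /next_phase (readsE _ E) p2.
have [] := scan_bits (drop_succ E); first by rewrite p3.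
set q := p.+1 + _; rewrite p3 rankE /hedge_end (readsE _ E) andbF addn0 => q3 rq sq dq.
have q4 : phase w q.+1 = 4 by rewrite phaseE /next_phase (readsE _ dq) q3.
have [] := scan_bits (drop_succ dq); first by rewrite q4.
set r := q.+1 + _; rewrite q4 rankE /hedge_end q3 addn0 => r4 rr sr dr.
have Er : p + size (edge_code (u, v)) = r.+1.
  rewrite /edge_code /fst /snd !binaryE size_cat size_map bu.
  rewrite [size (sep :: _)]/= size_rcons size_map [size (_ :: _)]/=.
  by rewrite /r /q !addSn !addnS addnA.
rewrite Er in D *; split=> //.
- by rewrite phaseE /next_phase (readsE _ dr) r4.
- by rewrite rankE /hedge_end r4 addn0 rr rq.
- rewrite [LHS]startsE ?(drop_lt E) // Es /info Eu Ev; congr cons.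
  rewrite -sq startsE ?(drop_lt dq) // /edge_start q3 -sr startsE ?(drop_lt dr) //.
  by rewrite /edge_start r4.
Qed.

Lemma scan_edges n (h : seq ('I_n * 'I_n)) p y : n < lim w ->
  let c := flatten (map (@edge_code n) h) in
  drop p w = c ++ y -> phase w p = 2 ->
  [/\ phase w (p + size c) = 2, rank w (p + size c) = rank w p,
      starts p = [seq (rank w p, val e.1, val e.2) | e <- h] ++ starts (p + size c)
    & drop (p + size c) w = y].
Proof.
move=> ltn; elim: h p => [|e h IH] p c E p2; first by rewrite /c addn0; split.
have Ec : c = edge_code e ++ flatten (map (@edge_code n) h) by [].
rewrite Ec -catA in E; rewrite Ec.
have [p2' r' s' d'] := scan_edge ltn E p2.
have [p2'' r'' s'' d''] := IH _ d' p2'.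
by rewrite size_cat addnA p2'' r'' s' s'' r'.
Qed.

Lemma scan_hedge n (h : seq ('I_n * 'I_n)) p y : n < lim w ->
  drop p w = hedge_code h ++ y -> phase w p = 2 ->
  let q := p + size (hedge_code h) in
  [/\ phase w q = 2, rank w q = (rank w p).+1,
      starts p = [seq (rank w p, val e.1, val e.2) | e <- h] ++ starts q
    & drop q w = y].
Proof.
move=> ltn E p2 q; rewrite /hedge_code cat_rcons in E.
have [] := scan_edges ltn E p2; set q' := p + _ => p2' r' s' d'.
have -> : q = q'.+1 by rewrite /q /hedge_code size_rcons addnS.
rewrite s'; split.
- by rewrite phaseE /next_phase (readsE _ d') p2'.
- by rewrite rankE /hedge_end p2' (readsE _ d') r' addn1.
- by rewrite [starts q']startsE ?(drop_lt d') // /edge_start (digit_sep d') andbF.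
- exact: drop_succ d'.
Qed.

Lemma scan_hedges n (hs : seq (seq ('I_n * 'I_n))) p j a b : n < lim w ->
  drop p w = flatten (map (@hedge_code n) hs) -> phase w p = 2 ->
  (j, a, b) \in starts p <->
  exists i (e : 'I_n * 'I_n),
    [/\ j = rank w p + i, e \in nth [::] hs i, a = e.1 & b = e.2].
Proof.
move=> ltn; elim: hs p => [|h hs IH] p E p2.
  rewrite /starts (eqP (_ : size w - p == 0)).
    by split=> // [[i [e []]]]; rewrite nth_nil.
  by rewrite -size_drop E.
have [p2' r' -> d'] := scan_hedge ltn E p2.
rewrite mem_cat; have {IH} := IH _ d' p2'; rewrite r' => IH; split.
  case/orP=> [/mapP[e eh [-> -> ->]]|/IH[i [e [-> ei -> ->]]]].
    by exists 0, e; rewrite addn0.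
  by exists i.+1, e; rewrite addSnnS.
case=> [[|i] [e [Ej ei Ea Eb]]]; apply/orP; [left|right].
  by rewrite Ej Ea Eb addn0; apply/mapP; exists e.
by apply/IH; exists i, e; rewrite addSnnS.
Qed.

End Scan.

Definition instance_word n k (hs : seq (seq ('I_n * 'I_n))) : seq letter :=
  nseq n (Some true) ++ sep :: binary k ++ sep :: flatten (map (@hedge_code n) hs).

Section Word.
Variables (n k : nat) (hs : seq (seq ('I_n * 'I_n))).
Let w := instance_word k hs.

(** Besides the unary header there are two separators and at least one digit of the budget. *)
Lemma size_word : n + 2 < size w.
Proof.
rewrite /w /instance_word size_cat size_nseq /= size_cat /= /binary size_map size_iota.
by rewrite ltn_add2l !addnS !ltnS.
Qed.

Lemma numeral_budget : numeral w (nxt w 0) = minn k (lim w).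
Proof.
have E : drop 0 w = map some (nseq n true) ++ sep ::
    binary k ++ sep :: flatten (map (@hedge_code n) hs).
  by rewrite drop0 map_nseq.
have D := drop_succ (drop_add E); rewrite size_map -(nxt_bits E) binaryE in D.
by rewrite (numeral_bits D) bitsK.
Qed.

Lemma edge_word u v j : edge w u v j <->
  exists2 e, e \in nth [::] hs j & (u, v) = (val e.1, val e.2) \/ (v, u) = (val e.1, val e.2).
Proof.
have ltn : n < lim w by rewrite ltnS; apply: leq_trans (leq_addr 2 n) (ltnW size_word).
have E : drop 0 w = map some (nseq n true) ++ sep ::
    binary k ++ sep :: flatten (map (@hedge_code n) hs).
  by rewrite drop0 map_nseq.
have [] := scan_bits E isT; rewrite add0n size_nseq => p0 r0 s0 d0.
have p1 : phase w n.+1 = 1 by rewrite phaseE /next_phase (readsE _ d0) p0.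
have r1 : rank w n.+1 = 0 by rewrite rankE r0 /hedge_end p0.
have s1 : starts w n.+1 = starts w 0.
  by rewrite -s0 [in RHS]startsE ?(drop_lt d0) // /edge_start p0.
have d1 := drop_succ d0; rewrite binaryE in d1.
have [] := scan_bits d1; first by rewrite p1.
set q := n.+1 + _; rewrite p1 r1 s1 => p2 r2 s2 d2.
have p3 : phase w q.+1 = 2 by rewrite phaseE /next_phase (readsE _ d2) p2.
have r3 : rank w q.+1 = 0 by rewrite rankE r2 /hedge_end p2.
have s3 : starts w q.+1 = starts w 0.
  by rewrite -s2 [in RHS]startsE ?(drop_lt d2) // /edge_start p2.
have S a b : (j, a, b) \in starts w 0 <->
    exists2 e, e \in nth [::] hs j & (a, b) = (val e.1, val e.2).
  have := scan_hedges j a b ltn (drop_succ d2) p3; rewrite s3 r3 => ->; split.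
    by case=> i [e [-> ei -> ->]]; exists e.
  by case=> e eh [-> ->]; exists j, e.
have S' a b : reflect (exists2 p, p < lim w & edge_start w p /\ info w p = (j, a, b))
    ((j, a, b) \in starts w 0).
  apply: (iffP mapP) => [[p]|[p ltp [ep ip]]].
    rewrite mem_filter mem_iota add0n subn0 => /andP[ep ltp] ip; exists p => //.
    exact: ltnW.
  exists p => //; rewrite mem_filter ep mem_iota add0n subn0 /=.
  (* The search includes the position [size w], just behind the last letter, where no edge
     starts. *)
  move: ep; rewrite /edge_start /digit /reads; case: ltnP => // gep.
  by rewrite !nth_default ?size_map // andbF.
split.
  case/hasP=> p; rewrite mem_iota add0n => ltp /and3P[ep /eqP rp /orP[]/andP[/eqP Eu /eqP Ev]].
    have /S[e eh Ee] : (j, u, v) \in starts w 0.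
      by apply/S'; exists p; rewrite // /info rp Eu Ev.
    by exists e; first by []; left.
  have /S[e eh Ee] : (j, v, u) \in starts w 0.
    by apply/S'; exists p; rewrite // /info rp Eu Ev.
  by exists e; first by []; right.
case=> e eh [] Ee.
  have /S'[p ltp [ep [rp Eu Ev]]] : (j, u, v) \in starts w 0 by apply/S; exists e.
  apply/hasP; exists p; first by rewrite mem_iota.
  by rewrite ep rp Eu Ev !eqxx.
have /S'[p ltp [ep [rp Eu Ev]]] : (j, v, u) \in starts w 0 by apply/S; exists e.
apply/hasP; exists p; first by rewrite mem_iota.
by rewrite ep rp Eu Ev !eqxx orbT.
Qed.

End Word.

(** * Guessing the clusters that meet a maximal packing *)

Lemma leq_card_bigcup (I T : finType) (A : {set I}) (F : I -> {set T}) :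
  #|\bigcup_(i in A) F i| <= \sum_(i in A) #|F i|.
Proof.
elim/big_rec2: _ => [|i m B _ leB]; first by rewrite cards0.
by apply: leq_trans (leq_add (leqnn _) leB); apply: leq_card_setU.
Qed.

Section Cliques.
Variable V : finType.
Implicit Types (F : {set {set V}}) (u v x : V).

(** The cliques are the classes of the relation of being equal or adjacent. *)
Lemma cliques_trans F : disjoint_union_of_cliques F <->
  forall u v x, u != x -> [set u; v] \in F -> [set v; x] \in F -> [set u; x] \in F.
Proof.
split=> [[P [/and3P[_ tiP _] FP]] u v x nux uvF vxF | tr].
  have [euv|nuv] := eqVneq u v; first by rewrite euv.
  have [evx|nvx] := eqVneq v x; first by rewrite -evx.
  have [B [BP uB vB]] := (FP u v nuv).1 uvF.
  have [C [CP vC xC]] := (FP v x nvx).1 vxF.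
  apply/(FP u x nux); exists B; split=> //.
  by rewrite -(def_pblock tiP BP vB) (def_pblock tiP CP vC).
pose R u v := (u == v) || ([set u; v] \in F).
have eqR : {in [set: V] & &, equivalence_rel R}.
  move=> u v x _ _ _; split; first by rewrite /R eqxx.
  have symR a b : R a b = R b a by rewrite /R eq_sym setUC.
  have trR a b d : R a b -> R b d -> R a d.
    rewrite /R; case: (eqVneq a b) => [->//|_] /= ab.
    case: (eqVneq b d) => [<-|_] /=; first by rewrite ab orbT.
    by move=> bd; case: (eqVneq a d) => //= nad; apply: tr ab bd.
  move=> uv; apply/idP/idP; apply: trR => //; by rewrite symR.
exists (equivalence_partition R [set: V]); split; first exact: equivalence_partitionP.
move=> u v nuv.
have := pblock_equivalence_partition eqR (in_setT u) (in_setT v).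
have /and3P[/eqP cov tiP _] := equivalence_partitionP eqR.
set Q := equivalence_partition R _ in cov tiP * => pbE.
have {}pbE : (v \in pblock Q u) = ([set u; v] \in F) by rewrite pbE /R (negPf nuv).
rewrite -pbE; split=> [vu|[B [BQ uB vB]]].
  by exists (pblock Q u); split; rewrite ?mem_pblock ?pblock_mem // cov in_setT.
by rewrite (def_pblock tiP BQ uB).
Qed.

Lemma set2_eq (a b u v : V) : [set a; b] = [set u; v] ->
  (u, v) = (a, b) \/ (v, u) = (a, b).
Proof.
move=> E; have : a \in [set u; v] by rewrite -E set21.
have : b \in [set u; v] by rewrite -E set22.
have : u \in [set a; b] by rewrite E set21.
have : v \in [set a; b] by rewrite E set22.
rewrite !inE => /orP[]/eqP-> /orP[]/eqP-> /orP[]/eqP ? /orP[]/eqP ?; subst; auto.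
Qed.

(** A path that avoids the vertices of a largest packing could be added to it. It need not be
    induced, so three pairwise adjacent vertices are excluded as well. *)
Lemma path_packing_cover (E : {set {set V}}) c : delta_max E <= c ->
  exists2 X : {set V}, #|X| <= 3 * c & forall u v x, uniq [:: u; v; x] ->
    [/\ u \notin X, v \notin X & x \notin X] ->
    [set u; v] \in E -> [set v; x] \notin E.
Proof.
move=> le_c.
have pk0 : F3_packing E set0.
  by apply/andP; split; apply/forall_inP=> S; rewrite inE.
case: (arg_maxnP (fun P : {set {set V} * {set {set V}}} => #|P|) pk0) => P pkP maxP.
have leP : #|P| <= c.
  by apply: leq_trans le_c; rewrite /delta_max (bigmax_sup P).
have /andP[/forall_inP memP /forall_inP disP] := pkP.
exists (\bigcup_(S in P) S.1) => [|u v x un [nu nv nx] uvE].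
  apply: leq_trans (leq_card_bigcup _ _) _.
  rewrite mulnC; apply: (@leq_trans (\sum_(S in P) 3)); last first.
    by rewrite sum_nat_const leq_mul2r leP orbT.
  apply: leq_sum => S /memP/andP[_ /orP[]] /existsP[f /and3P[_ /eqP-> _]];
    by apply: leq_trans (leq_imset_card _ _) _; rewrite card_ord.
apply/negP=> vxE.
pose f := [ffun i : 'I_3 => nth u [:: u; v; x] i].
pose S := ([set f i | i : 'I_3], [set [set f i | i in e] | e : {set 'I_3} in P3]).
have notX i : f i \notin \bigcup_(S in P) S.1.
  by rewrite ffunE; case: i => [[|[|[|]]]].
have disS T : T \in P -> [disjoint S.1 & T.1].
  move=> TP; apply/pred0P=> a /=; apply/negbTE/negP=> /andP[/imsetP[i _ ->] fT].
  by have /bigcupP[] := notX i; exists T.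
have SP : S \notin P.
  apply/negP=> /disS/pred0P/(_ (f ord0)) /=; by rewrite !imset_f.
have := maxP (S |: P); rewrite cardsU1 SP /= add1n ltnn => maxS.
apply/notF/maxS.
apply/andP; split; apply/forall_inP=> T; rewrite in_setU1.
  case/orP=> [/eqP->|/memP//]; apply/andP; split; last first.
    apply/orP; left; apply/existsP; exists f; rewrite !eqxx !andbT.
    apply/injectiveP=> i j; rewrite !ffunE => /eqP.
    by rewrite nth_uniq // => /eqP/val_inj.
  apply/andP; split.
    apply/subsetP=> _ /imsetP[e + ->]; rewrite !inE => /orP[]/eqP->;
      by rewrite imsetU1 imset_set1 !ffunE !inordK.
  by apply/forall_inP=> _ /imsetP[e _ ->]; apply: imsetS; apply: subset_predT.
case/orP=> [/eqP->|TP]; apply/forall_inP=> T'; rewrite in_setU1 => /orP[/eqP->|TP'].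
- by rewrite eqxx.
- by apply/implyP=> _; apply: disS.
- by apply/implyP=> _; rewrite disjoint_sym; apply: disS.
- exact: (forall_inP (disP T TP)).
Qed.

End Cliques.

(** * The hedges cut by a relation on the vertices *)

Section Hedges.
Variables (V : finType) (H : hedge_graph V).

Lemma edge_neq u v : [set u; v] \in edges H -> u != v.
Proof.
move=> uvE; have /forall_inP simpleE := edges_simple H; move: (simpleE _ uvE).
by rewrite cards2; case: (u != v).
Qed.

Lemma edge_hedge e : e \in edges H -> exists2 h, h \in hedges H & e \in h.
Proof.
have /and3P[/eqP <- _ _] := hedges_partition H.
by case/bigcupP=> h; exists h.
Qed.

Lemma hedge_edge h e : h \in hedges H -> e \in h -> e \in edges H.
Proof.
have /and3P[/eqP <- _ _] := hedges_partition H.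
by move=> hH eh; apply/bigcupP; exists h.
Qed.

Lemma hedge_uniq h h' e : h \in hedges H -> h' \in hedges H -> e \in h -> e \in h' -> h = h'.
Proof.
have /and3P[_ tiH _] := hedges_partition H => hH hH' eh eh'.
by rewrite -(def_pblock tiH hH eh) (def_pblock tiH hH' eh').
Qed.

(** The counterpart of [cut] for an arbitrary relation in place of the guessed list. *)
Definition is_cut (R : rel V) (h : {set {set V}}) : bool :=
  [exists v, exists u, [&& [set u; v] \in h, R u u & ~~ R u v]].

Definition cut_hedges (R : rel V) : {set {set {set V}}} := [set h in hedges H | is_cut R h].

Lemma delete_cutP R e : reflect (exists h, [/\ h \in hedges H, e \in h & ~~ is_cut R h])
  (e \in delete_hedges H (cut_hedges R)).
Proof.
rewrite inE; apply: (iffP andP) => [[ncov eE]|[h [hH eh nc]]].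
  have [h hH eh] := edge_hedge eE; exists h; split=> //.
  by apply: contra ncov => ch; apply/bigcupP; exists h; rewrite // inE hH.
split; last exact: hedge_edge eh.
apply/bigcupP=> [[h']]; rewrite inE => /andP[hH' ch'] eh'.
by rewrite (hedge_uniq hH hH' eh eh') ch' in nc.
Qed.

(** At most [3 * c] vertices in [X], each in a cluster of at most [3 * c + 2] vertices; the square
    counts ordered pairs. *)
Definition pairs_bound c := (3 * c * (3 * c + 2)) ^ 2.

Lemma guess_exists k c : delta_max (edges H) <= c -> hedge_cluster_deletion H k ->
  exists A : {set V * V}, let R := fun u v => (u, v) \in A in
  [/\ #|A| <= pairs_bound c, #|cut_hedges R| <= k
    & disjoint_union_of_cliques (delete_hedges H (cut_hedges R))].
Proof.
move=> le_c [U [UH leU cl]]; have [X leX XP] := path_packing_cover le_c.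
have [Q [partQ FQ]] := cl.
have /and3P[/eqP covQ tiQ _] := partQ.
have pb u : u \in pblock Q u by rewrite mem_pblock covQ in_setT.
have pbQ u : pblock Q u \in Q by rewrite pblock_mem // covQ in_setT.
have same u v : u \in pblock Q v -> pblock Q u = pblock Q v.
  by move=> uv; apply: def_pblock.
have sym u v : u \in pblock Q v -> v \in pblock Q u by move=> /same->.
have inU u v : u != v -> v \in pblock Q u -> [set u; v] \in delete_hedges H U.
  by move=> nuv vu; apply/(FQ u v nuv); exists (pblock Q u).
have inE_ e : e \in delete_hedges H U -> e \in edges H by rewrite inE => /andP[].
(* The vertices of the clusters that meet [X]; below, [A] is the relation of lying in a common such
   cluster. *)
pose W := [set v | ~~ [disjoint pblock Q v & X]].
have WX x : x \in X -> x \in W.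
  by move=> xX; rewrite inE; apply/pred0Pn; exists x; rewrite /= pb.
have Wsame u v : u \in W -> v \in pblock Q u -> v \in W.
  by rewrite !inE => uW /same->.
pose A := [set p : V * V | (p.1 \in W) && (p.2 \in pblock Q p.1)].
exists A => R.
have RE u v : R u v = (u \in W) && (v \in pblock Q u) by rewrite /R inE.
(* A cut hedge contains an edge between two clusters of the solution, so [U] had to delete it. *)
have cutU : cut_hedges R \subset U.
  apply/subsetP=> h; rewrite inE => /andP[hH /existsP[v /existsP[u /and3P[uvh]]]].
  rewrite !RE pb andbT => uW; rewrite uW /= => nvu.
  have uvE := hedge_edge hH uvh; have nuv := edge_neq uvE.
  have : [set u; v] \notin delete_hedges H U.
    apply: contra nvu => /(FQ u v nuv)[B [BQ uB vB]].
    by rewrite (def_pblock tiQ BQ uB).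
  rewrite inE uvE andbT negbK => /bigcupP[h' h'U uvh'].
  by rewrite (hedge_uniq hH (subsetP UH _ h'U) uvh uvh').
split; last 1 first.
- apply/cliques_trans=> u v x nux.
  move=> /delete_cutP[h [hH uvh nch]] /delete_cutP[h' [hH' vxh' nch']].
  have uvE := hedge_edge hH uvh; have vxE := hedge_edge hH' vxh'.
  (* An edge of an uncut hedge with one end in [W] stays inside the cluster of that end. *)
  have close a b (g : {set {set V}}) : [set a; b] \in g -> ~~ is_cut R g -> a \in W -> b \in pblock Q a.
    move=> abg ng aW; apply: contraR ng => nb.
    by apply/existsP; exists b; apply/existsP; exists a; rewrite abg !RE aW pb.
  have uvh2 := uvh; rewrite setUC in uvh2; have vxh2 := vxh'; rewrite setUC in vxh2.
  have [vW|vW] := boolP (v \in W).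
    have uv := close _ _ _ uvh2 nch vW; have xv := close _ _ _ vxh' nch' vW.
    (* All three vertices lie in one cluster, where [U] deletes nothing, and hence neither does its
       subset of cut hedges. *)
    have : [set u; x] \in delete_hedges H U by apply: inU; rewrite // (same _ _ uv).
    rewrite !inE => /andP[ncov ->]; rewrite andbT; apply: contra ncov.
    by case/bigcupP=> g gc ug; apply/bigcupP; exists g; rewrite ?(subsetP cutU).
  (* If [v] is outside [W], so are its neighbours; the two edges would then form a path outside
     [X]. *)
  have uW : u \notin W by apply: contra vW => uW; exact: Wsame (uW) (close _ _ _ uvh nch uW).
  have xW : x \notin W by apply: contra vW => xW; exact: Wsame (xW) (close _ _ _ vxh2 nch' xW).
  have un : uniq [:: u; v; x].
    by rewrite /= !inE negb_or nux (edge_neq uvE) (edge_neq vxE).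
  have nX : [/\ u \notin X, v \notin X & x \notin X].
    by split; [apply: contra uW|apply: contra vW|apply: contra xW]; apply: WX.
  by have := XP u v x un nX uvE; rewrite vxE.
- have leB x : #|pblock Q x| <= 3 * c + 2.
    rewrite -(cardsID X); apply: leq_add.
      by apply: leq_trans leX; apply/subset_leq_card/subsetIr.
    rewrite leqNgt; apply/negP=> /card_gt2P[a [b [d [[aD bD dD] [nab nbd nda]]]]].
    move: aD bD dD; rewrite !inE => /andP[aX ax] /andP[bX bx] /andP[dX dx].
    have un : uniq [:: a; b; d] by rewrite /= !inE negb_or nab nbd eq_sym nda.
    have abE : [set a; b] \in edges H by apply/inE_/inU; rewrite // (same _ _ ax).
    have bdE : [set b; d] \in edges H by apply/inE_/inU; rewrite // (same _ _ bx).
    have nX : [/\ a \notin X, b \notin X & d \notin X] by [].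
    by have := XP a b d un nX abE; rewrite bdE.
  have leW : #|W| <= 3 * c * (3 * c + 2).
    apply: (@leq_trans #|\bigcup_(x in X) pblock Q x|).
      apply: subset_leq_card; apply/subsetP=> v; rewrite inE => /pred0Pn[x /andP[/= xv xX]].
      by apply/bigcupP; exists x; rewrite // sym.
    apply: leq_trans (leq_card_bigcup _ _) _.
    apply: (@leq_trans (\sum_(x in X) (3 * c + 2))); first exact: leq_sum.
    by rewrite sum_nat_const leq_mul2r leX orbT.
  rewrite /pairs_bound; apply: (@leq_trans (#|W| ^ 2)); last by rewrite leq_sqr.
  rewrite -mulnn -cardsX; apply/subset_leq_card/subsetP=> [[u v]].
  by rewrite !inE /= => /andP[uW vu]; rewrite uW; have := Wsame u v; rewrite !inE => ->.
- by apply: leq_trans leU; apply: subset_leq_card.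
Qed.

End Hedges.

(** * Correctness of the search *)

Lemma num_vertices_lt n k (hs : seq (seq ('I_n * 'I_n))) : n < size (instance_word k hs).
Proof. exact: leq_ltn_trans (leq_addr 2 n) (size_word k hs). Qed.

Section Correct.
Variables (n k : nat) (H : hedge_graph 'I_n) (hs : seq (seq ('I_n * 'I_n))).
Hypothesis lists : perm_eq [seq [set e in map (@edge_of n) h] | h <- hs] (enum (hedges H)).
Let w := instance_word k hs.

Definition hedge_at j : {set {set 'I_n}} := [set e in map (@edge_of n) (nth [::] hs j)].

Lemma mem_hedges h : (h \in hedges H) = (h \in [seq hedge_at j | j <- iota 0 (size hs)]).
Proof.
rewrite -mem_enum -(perm_mem lists); congr (_ \in _).
by rewrite -[in LHS](mkseq_nth [::] hs) -map_comp.
Qed.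

Lemma hedge_at_mem j : j < size hs -> hedge_at j \in hedges H.
Proof. by move=> ltj; rewrite mem_hedges map_f // mem_iota. Qed.

(** The search tries all indices below [lim w]; those beyond the last hedge stand for empty hedges,
    which are never cut. *)
Lemma hedge_at_default j : size hs <= j -> hedge_at j = set0.
Proof. by move=> lej; apply/setP=> e; rewrite /hedge_at nth_default // !inE. Qed.

Lemma edge_wordE (u v : 'I_n) j : edge w u v j = ([set u; v] \in hedge_at j).
Proof.
rewrite inE; apply/idP/mapP.
  case/edge_word=> -[a b] abh [[/val_inj eu /val_inj ev]|[/val_inj ev /val_inj eu]];
    exists (a, b); rewrite // /edge_of eu ev //=.
  by rewrite setUC.
case=> -[a b] abh; rewrite /edge_of /= => /esym/set2_eq E.
by apply/edge_word; exists (a, b); rewrite //=; case: E => [][-> ->]; [left|right].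
Qed.

(** The search also tries numbers that are not vertices; no edge ends there, so they have no
    effect. *)
Lemma edge_word_vertices u v j : edge w u v j ->
  exists a b : 'I_n, u = a /\ v = b.
Proof.
by case/edge_word=> -[a b] _ [[-> ->]|[-> ->]]; [exists a, b|exists b, a].
Qed.

(** Each hedge contributes at least its final separator to the word. *)
Lemma size_hedges : size hs <= lim w.
Proof.
have -> : w = (nseq n (Some true) ++ sep :: rcons (binary k) sep) ++
    flatten (map (@hedge_code n) hs) by rewrite -catA cat_cons cat_rcons.
apply: leqW; rewrite size_cat; apply: leq_trans (leq_addl _ _).
elim: (hs) => //= h hs' IH; rewrite size_cat {1}/hedge_code size_rcons addSn ltnS.
by apply: leq_trans IH (leq_addl _ _).
Qed.

Variables (d : nat) (ts : seq nat).
Let R : rel 'I_n := fun u v => linked d ts u v.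

Lemma vertex_lim (u : 'I_n) : u < lim w.
Proof.
exact: ltn_trans (ltn_ord u) (leqW (num_vertices_lt k hs)).
Qed.

Lemma cut_wordE j : cut d w ts j = is_cut R (hedge_at j).
Proof.
apply/hasP/existsP => [[v _ /hasP[u _ /and3P[uv Ru Ruv]]]|[v /existsP[u /and3P[uv Ru Ruv]]]].
  have [a [b [Eu Ev]]] := edge_word_vertices uv; subst u v.
  by exists b; apply/existsP; exists a; rewrite -edge_wordE uv /R Ru.
exists (val v); first by rewrite mem_iota; apply: vertex_lim.
apply/hasP; exists (val u); first by rewrite mem_iota; apply: vertex_lim.
by apply/and3P; split; rewrite /= ?edge_wordE.
Qed.

Lemma count_cut : count (cut d w ts) (iota 0 (lim w)) = #|cut_hedges H R|.
Proof.
have -> : #|cut_hedges H R| = count (is_cut R) (enum (hedges H)).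
  rewrite cardE /enum_mem -size_filter -filter_predI; congr (size _).
  by apply: eq_filter => h; rewrite /= !inE andbC.
rewrite -(permP lists) count_map -(subnKC size_hedges) iotaD count_cat add0n.
rewrite [X in _ + X](@eq_in_count _ _ pred0) ?count_pred0 ?addn0; last first.
  move=> j; rewrite mem_iota => /andP[lej _]; rewrite cut_wordE hedge_at_default //.
  by apply/existsP=> [[v /existsP[u]]]; rewrite inE.
rewrite -[in RHS](mkseq_nth [::] hs) count_map.
by apply: eq_count => j; rewrite /= cut_wordE.
Qed.

Lemma kept_wordE (u v : 'I_n) :
  kept d w ts u v = ([set u; v] \in delete_hedges H (cut_hedges H R)).
Proof.
apply/hasP/delete_cutP => [[j _ /andP[uv nc]]|[h [hH uv nc]]].
  exists (hedge_at j); rewrite -edge_wordE uv -cut_wordE nc; split=> //.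
  apply: hedge_at_mem; rewrite ltnNge; apply/negP=> /hedge_at_default E.
  by rewrite edge_wordE E inE in uv.
move: hH; rewrite mem_hedges => /mapP[j]; rewrite mem_iota => ltj Eh; subst h.
exists j; last by rewrite edge_wordE uv cut_wordE.
by rewrite mem_iota; apply: leq_trans ltj size_hedges.
Qed.

Lemma kept_vertices u v : kept d w ts u v -> exists a b : 'I_n, u = a /\ v = b.
Proof. by case/hasP=> j _ /andP[/edge_word_vertices]. Qed.

Lemma good_wordP : reflect (#|cut_hedges H R| <= k /\
    disjoint_union_of_cliques (delete_hedges H (cut_hedges H R))) (good d w ts).
Proof.
(* The count never exceeds [lim w], so it may be compared with the truncated budget. *)
have le_l : count (cut d w ts) (iota 0 (lim w)) <= lim w.
  by apply: leq_trans (count_size _ _) _; rewrite size_iota.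
rewrite /good numeral_budget leq_min le_l andbT count_cut.
have in_lim (u : 'I_n) : val u \in iota 0 (lim w) by rewrite mem_iota; apply: vertex_lim.
apply: (iffP andP) => -[le_k tr]; split=> //.
  apply/cliques_trans=> u v x nux; rewrite -!kept_wordE => uv vx.
  move/allP: tr => /(_ _ (in_lim x))/allP/(_ _ (in_lim v))/allP/(_ _ (in_lim u)).
  by rewrite uv vx /= val_eqE (negPf nux).
move/cliques_trans in tr.
apply/allP=> x _; apply/allP=> v _; apply/allP=> u _.
case: eqP => //= /eqP nux; case uv: (kept d w ts u v) => //=.
case vx: (kept d w ts v x) => //=.
have [a [b [Eu Ev]]] := kept_vertices uv; have [_ [e [_ Ex]]] := kept_vertices vx.
by subst u v x; move: uv vx; rewrite !kept_wordE; apply: tr.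
Qed.

End Correct.

Lemma linked_pairs (ps : seq (nat * nat)) u v :
  linked (size ps) (flatten [seq [:: p.1; p.2] | p <- ps]) u v = ((u, v) \in ps).
Proof.
rewrite /linked; elim: ps => [//|[a b] ps IH].
rewrite [size _]/= -add1n iotaD has_cat [has _ (iota 0 1)]/= orbF in_cons -IH xpair_eqE.
rewrite ![_ == u]eq_sym ![_ == v]eq_sym; congr (_ || _).
by rewrite -[0 + 1]/(1 + 0) iotaDl has_map.
Qed.

Lemma pad_seq (T : eqType) m (s : seq T) x : size s <= m ->
  size (s ++ nseq (m - size s) x) = m.
Proof. by move=> les; rewrite size_cat size_nseq subnKC. Qed.

Lemma somes_goodP c n k (H : hedge_graph 'I_n) hs :
  perm_eq [seq [set e in map (@edge_of n) h] | h <- hs] (enum (hedges H)) ->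
  delta_max (edges H) <= c ->
  let w := instance_word k hs in let d := pairs_bound c in
  somes d.*2 (good d) w [::] <-> hedge_cluster_deletion H k.
Proof.
move=> lists le_c w d; split.
  case/somesP=> ts [_ _]; rewrite cats0 => /(good_wordP _ lists)[leU cl].
  exists (cut_hedges H (fun u v => linked d ts u v)); split=> //.
  by apply/subsetP=> h; rewrite inE => /andP[].
move=> /(guess_exists le_c)[A [leA leU cl]].
pose ps0 := [seq (val p.1, val p.2) | p <- enum A].
(* The list is padded to exactly [d] pairs with [size w], which is below [lim w] as a guess must be,
   but is not a vertex. *)
pose ps := ps0 ++ nseq (d - size ps0) (size w, size w).
have sps : size ps = d by apply: pad_seq; rewrite size_map -cardE.
have Eps (u v : 'I_n) : linked d (flatten [seq [:: p.1; p.2] | p <- ps]) u v = ((u, v) \in A).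
  rewrite -sps linked_pairs mem_cat mem_nseq xpair_eqE.
  rewrite [val u == size w]ltn_eqF ?andbF ?orbF; last first.
    exact: ltn_trans (ltn_ord u) (num_vertices_lt k hs).
  apply/mapP/idP => [[[a b]]|uvA]; last by exists (u, v); rewrite ?mem_enum.
  by rewrite mem_enum => abA [/val_inj-> /val_inj->].
apply/somesP; exists (flatten [seq [:: p.1; p.2] | p <- ps]); split.
- by rewrite -sps; elim: (ps) => //= p ps' ->; rewrite doubleS.
- have : all (fun p => (p.1 < lim w) && (p.2 < lim w)) ps.
    rewrite all_cat all_nseq /= !ltnS leqnn orbT andbT; apply/allP=> _ /mapP[p _ ->] /=.
    by rewrite !vertex_lim.
  by elim: (ps) => //= p ps' IH /andP[/andP[-> ->]] /IH.
rewrite cats0; apply/(good_wordP _ lists).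
set R := fun u v => linked _ _ _ _.
have ER : cut_hedges H R = cut_hedges H (fun u v => (u, v) \in A).
  apply/setP=> h; rewrite !inE; congr (_ && _).
  by apply: eq_existsb => v; apply: eq_existsb => u; rewrite /R !Eps.
by rewrite ER.
Qed.

Theorem theorem3p3 (c : nat) :
  polytime_solvable_on encodes
    (fun x : hcd_instance => hedge_cluster_deletion (graph x) (budget x))
    (fun x : hcd_instance => delta_max (edges (graph x)) <= c).
Proof.
pose d := pairs_bound c.
have [M [p MP]] := computable_decides (testable_somes d.*2 (testable_good d)).
exists M, p => w [n H k] [hs [/= lists _] Ew] le_c.
have {}Ew : w = instance_word k hs by [].
have w2 : 2 < size w by rewrite Ew; apply: leq_ltn_trans (size_word k hs); apply: leq_addl.
have [acc rej] := MP w w2; rewrite Ew in acc rej *.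
have S := somes_goodP k lists le_c.
split=> [yes|no]; first by apply: acc; rewrite (S.2 yes).
by apply: rej; apply/eqP; rewrite eqb0; apply/negP=> /S.
Qed.
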